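(* Let $K$ be a field of characteristic $\neq 2$. Let $M=\bigoplus_{\mu\in X}M_\mu$ be an $X$-graded $K$-vector space, and for each $\alpha\in\Pi$ let $F_\alpha\colon M\to M$ be a $K$-linear map that is homogeneous of degree $-\alpha$. Assume that there is a finite subset $T\subset M$ such that the smallest $K$-subspace of $M$ that contains $T$ and is stable under all $F_\alpha$, $\alpha\in\Pi$, is $M$ itself. Then the following are equivalent. (1) There exists an HR-form on $M$. (2) There exists a structure of a semisimple $X$-graded representation of $\mathfrak g$ on $M=\bigoplus_{\mu\in X}M_\mu$ such that for all $\alpha\in\Pi$ the homomorphism $F_\alpha$ is the action map of the Chevalley generator $f_\alpha$ corresponding to $-\alpha$.
   Context: Root data. $R$ is a finite (reduced, crystallographic) root system in a real vector space, $\Pi\subset R$ is a basis, $\alpha^\vee$ is the coroot of $\alpha$, and $X$ is the weight lattice. The partial order on $X$ is: $\lambda\le\mu$ iff $\mu-\lambda$ is a sum of elements of $\Pi$ (nonnegative integer combination). A subset $I\subset X$ is closed if $\mu\in I$ and $\mu\le\nu$ imply $\nu\in I$. For a closed subset $I$, $M_I\subset M$ denotes the smallest $K$-subspace containing all $M_\mu$ with $\mu\in I$ and stable under all $F_\alpha$. HR-form. A $K$-bilinear form $(\cdot,\cdot)\colon M\times M\to K$ is an HR-form if: (i) it is symmetric and non-degenerate; (ii) $M_\mu$ and $M_\nu$ are orthogonal if $\mu\ne\nu$; (iii) for any closed subset $I\subset X$ the restriction of $(\cdot,\cdot)$ to $M_I\times M_I$ is non-degenerate; (iv) denoting by $E_\alpha\colon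 M\to M$ the adjoint of $F_\alpha$ with respect to $(\cdot,\cdot)$, one has $[E_\alpha,F_\alpha]|_{M_\mu}=\langle\mu,\alpha^\vee\rangle\cdot\mathrm{id}_{M_\mu}$ for all $\alpha\in\Pi$, $\mu\in X$, and $[E_\alpha,F_\beta]=0$ for $\alpha\neq\beta$ in $\Pi$. Lie algebra. $\mathfrak g$ is the split semisimple Lie algebra over $K$ with root system $R$, given by generators $e_\alpha,f_\alpha,h_\alpha$ ($\alpha\in\Pi$) and relations $[h_\alpha,h_\beta]=0$, $[h_\alpha,e_\beta]=\langle\beta,\alpha^\vee\rangle e_\beta$, $[h_\alpha,f_\beta]=-\langle\beta,\alpha^\vee\rangle f_\beta$, $[e_\alpha,f_\alpha]=h_\alpha$, $[e_\alpha,f_\beta]=0$ for $\alpha\neq\beta$, and the usual Serre relations for the $e_\alpha$ and for the $f_\alpha$. $\mathfrak h$ is the span of the $h_\alpha$, $\mathfrak n^-$ is the subalgebra generated by the $f_\alpha$, and $\mathfrak b^-=\mathfrak n^-\oplus\mathfrak h$. $X$-graded representations. An $X$-graded representation of $\mathfrak g$ is an $X$-graded $K$-vector space $M=\bigoplus_{\mu\in X}M_\mu$ with a $\mathfrak g$-module structure such that, for all $\alpha\in\Pi$, $e_\alpha$ and $f_\alpha$ act homogeneously of degree $+\alpha$ and $-\alpha$, respectively, $h_\alpha$ acts on $M_\mu$ as multiplication by $\langle\mu,\alpha^\vee\rangle$, and $M$ is finitely generated as a $U(\mathfrak b^-)$-module. Morphisms are grading-preserving $\mathfrak g$-homomorphisms.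 For each $\lambda\in X$ there is, up to isomorphism, a unique irreducible $X$-graded representation $L(\lambda)$ with highest weight $\lambda$ (generated by a nonzero $v\in L(\lambda)_\lambda$ with $e_\alpha v=0$ for all $\alpha\in\Pi$). An $X$-graded representation is semisimple if it is isomorphic to a (finite) direct sum of copies of various $L(\lambda)$'s. *)

(* Defs.v *)
From HB Require Import structures.
From mathcomp Require Import all_boot all_order all_algebra.
From mathcomp Require Import sesquilinear generic_quotient.
From mathcomp Require Import all_classical all_reals.
Set Implicit Arguments.
Unset Strict Implicit.
Unset Printing Implicit Defensive.
Import Order.TTheory GRing.Theory Num.Theory.
Local Open Scope classical_set_scope.
Local Open Scope quotient_scope.
Local Open Scope ring_scope.

(* The values of [coroot] outside [roots] are irrelevant; on [roots] they are
   determined by the axioms. *)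
Record root_system (rR : realType) (V : vectType rR) := RootSystem {
  roots : seq V;
  coroot : V -> 'Hom(V, rR^o);
  roots_span : <<roots>>%VS = fullv;
  roots_neq0 : 0 \notin roots;
  coroot2 : forall a, a \in roots -> coroot a a = 2;
  roots_refl : forall a b, a \in roots -> b \in roots ->
    b - (coroot a b : rR) *: a \in roots;
  coroot_int : forall a b, a \in roots -> b \in roots ->
    (coroot a b : rR) \is a Num.int;
  roots_reduced : forall a (c : rR), a \in roots -> c *: a \in roots ->
    c = 1 \/ c = -1
}.

Record root_basis (rR : realType) (V : vectType rR) (R : root_system V) :=
  RootBasis {
  simple_roots : seq V;
  simple_sub : {subset simple_roots <= roots R};
  simple_basis : basis_of fullv simple_roots;
  simple_sign : forall b, b \in roots R ->
    exists k : seq_sub simple_roots -> nat,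
      b = \sum_a val a *+ k a \/ b = - \sum_a val a *+ k a
}.

Section Weights.
Context (rR : realType) (V : vectType rR) (R : root_system V).

Definition is_weight : {pred V} :=
  [pred v | all (fun a => (coroot R a v : rR) \is a Num.int) (roots R)].

Lemma is_weight_zmod_closed : zmod_closed is_weight.
Proof.
split=> [|u v /allP uX /allP vX]; apply/allP => a aR; first by rewrite linear0 rpred0.
by rewrite linearB rpredB //; [exact: uX | exact: vX].
Qed.

HB.instance Definition _ :=
  GRing.isZmodClosed.Build V is_weight is_weight_zmod_closed.

Record weight := Weight { weight_val :> V; _ : weight_val \in is_weight }.

HB.instance Definition _ := [isSub for weight_val].
HB.instance Definition _ := [Choice of weight by <:].
HB.instance Definition _ := [SubChoice_isSubZmodule of weight by <:].

(* <v, a^vee>, as an integer; only used where the coroot takes an integral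
   value, so that taking the floor loses nothing. *)
Definition pairing (v a : V) : int := Num.floor (coroot R a v : rR).

Context (Pi : root_basis R).

Definition simple := seq_sub (simple_roots Pi).

Lemma simple_is_weight (a : simple) : val a \in is_weight.
Proof.
by apply/allP => b bR; apply: coroot_int => //; apply: simple_sub; exact: valP.
Qed.

Definition simple_weight (a : simple) : weight := Weight (simple_is_weight a).

Definition weight_le (l m : weight) : Prop :=
  exists k : simple -> nat, m - l = \sum_a simple_weight a *+ k a.

Definition closed_weights (I : set weight) : Prop :=
  forall m n, I m -> weight_le m n -> I n.

End Weights.

Section Subspaces.
Context (K : fieldType) (M : lmodType K).

Definition subspace (A : set M) : Prop :=
  A 0 /\ forall (c : K) u v, A u -> A v -> A (c *: u + v).

Definition stable_subspace (T : Type) (D : set T) (f : T -> M -> M) (A : set M) :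
  Prop := subspace A /\ forall t m, D t -> A m -> A (f t m).

Definition span_stable (T : Type) (D : set T) (f : T -> M -> M) (G : set M) :
  set M := smallest (stable_subspace D f) G.

End Subspaces.

(* The Lie algebra presented by the Chevalley generators and the Serre relations
   of a matrix [A], where [A a b] stands for <b, a^vee>: Lie words modulo the
   smallest congruence containing the axioms of Lie algebras over [K] and the
   defining relations. *)
Section ChevalleySerre.
Context (K : fieldType) (I : finType) (A : I -> I -> int).

Inductive lie_word :=
| WE of I
| WF of I
| WH of I
| WZero
| WOpp of lie_word
| WAdd of lie_word & lie_word
| WScale of K & lie_word
| WBr of lie_word & lie_word.

Inductive lie_cong : lie_word -> lie_word -> Prop :=
| cong_refl x : lie_cong x x
| cong_sym x y : lie_cong x y -> lie_cong y x
| cong_trans x y z : lie_cong x y -> lie_cong y z -> lie_cong x z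
| cong_opp x x' : lie_cong x x' -> lie_cong (WOpp x) (WOpp x')
| cong_add x x' y y' : lie_cong x x' -> lie_cong y y' ->
    lie_cong (WAdd x y) (WAdd x' y')
| cong_scale c x x' : lie_cong x x' -> lie_cong (WScale c x) (WScale c x')
| cong_br x x' y y' : lie_cong x x' -> lie_cong y y' ->
    lie_cong (WBr x y) (WBr x' y')
| cong_addA x y z : lie_cong (WAdd x (WAdd y z)) (WAdd (WAdd x y) z)
| cong_addC x y : lie_cong (WAdd x y) (WAdd y x)
| cong_add0 x : lie_cong (WAdd WZero x) x
| cong_addN x : lie_cong (WAdd (WOpp x) x) WZero
| cong_scaleA c d x : lie_cong (WScale c (WScale d x)) (WScale (c * d) x)
| cong_scale1 x : lie_cong (WScale 1 x) x
| cong_scaleDr c x y :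
    lie_cong (WScale c (WAdd x y)) (WAdd (WScale c x) (WScale c y))
| cong_scaleDl c d x :
    lie_cong (WScale (c + d) x) (WAdd (WScale c x) (WScale d x))
| cong_brDl x y z : lie_cong (WBr (WAdd x y) z) (WAdd (WBr x z) (WBr y z))
| cong_brDr x y z : lie_cong (WBr x (WAdd y z)) (WAdd (WBr x y) (WBr x z))
| cong_brZl c x y : lie_cong (WBr (WScale c x) y) (WScale c (WBr x y))
| cong_brZr c x y : lie_cong (WBr x (WScale c y)) (WScale c (WBr x y))
| cong_brxx x : lie_cong (WBr x x) WZero
| cong_jacobi x y z :
    lie_cong (WAdd (WBr x (WBr y z)) (WAdd (WBr y (WBr z x)) (WBr z (WBr x y))))
             WZero
| cong_HH a b : lie_cong (WBr (WH a) (WH b)) WZero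
| cong_HE a b : lie_cong (WBr (WH a) (WE b)) (WScale (A a b)%:~R (WE b))
| cong_HF a b : lie_cong (WBr (WH a) (WF b)) (WScale (- (A a b)%:~R) (WF b))
| cong_EF a : lie_cong (WBr (WE a) (WF a)) (WH a)
| cong_EF0 a b : a != b -> lie_cong (WBr (WE a) (WF b)) WZero
| cong_serreE a b : a != b ->
    lie_cong (iter `|1 - A a b|%N (WBr (WE a)) (WE b)) WZero
| cong_serreF a b : a != b ->
    lie_cong (iter `|1 - A a b|%N (WBr (WF a)) (WF b)) WZero.

HB.instance Definition _ := gen_eqMixin lie_word.
HB.instance Definition _ := gen_choiceMixin lie_word.

Definition lie_congb : rel lie_word := fun x y => `[<lie_cong x y>].

Lemma lie_congb_equiv : equiv_class_of lie_congb.
Proof.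
split=> [x|x y|y x z]; first by apply/asboolP/cong_refl.
  by apply/asboolP/asboolP => /cong_sym.
by move=> /asboolP xy /asboolP yz; apply/asboolP/(cong_trans xy).
Qed.

Canonical lie_cong_equiv := EquivRelPack lie_congb_equiv.

Definition lie_alg := {eq_quot lie_congb}.
HB.instance Definition _ := Choice.on lie_alg.
HB.instance Definition _ := EqQuotient.on lie_alg.

Definition lie_pi (x : lie_word) : lie_alg := \pi_lie_alg x.

Lemma lie_piP x y : lie_pi x = lie_pi y <-> lie_cong x y.
Proof.
split=> [/eqP|xy]; first by rewrite eqmodE => /asboolP.
by apply/eqP; rewrite eqmodE; apply/asboolP.
Qed.

Lemma lie_repr x : lie_cong (repr (lie_pi x)) x.
Proof. by apply/lie_piP; rewrite /lie_pi reprK. Qed.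

Definition lie_zero : lie_alg := lie_pi WZero.
Definition lie_opp (x : lie_alg) : lie_alg := lie_pi (WOpp (repr x)).
Definition lie_add (x y : lie_alg) : lie_alg := lie_pi (WAdd (repr x) (repr y)).
Definition lie_scale (c : K) (x : lie_alg) : lie_alg := lie_pi (WScale c (repr x)).
Definition lie_br (x y : lie_alg) : lie_alg := lie_pi (WBr (repr x) (repr y)).

Lemma lie_oppE x : lie_opp (lie_pi x) = lie_pi (WOpp x).
Proof. by apply/lie_piP/cong_opp/lie_repr. Qed.
Lemma lie_addE x y : lie_add (lie_pi x) (lie_pi y) = lie_pi (WAdd x y).
Proof. by apply/lie_piP/cong_add; apply: lie_repr. Qed.
Lemma lie_scaleE c x : lie_scale c (lie_pi x) = lie_pi (WScale c x).
Proof. by apply/lie_piP/cong_scale/lie_repr. Qed.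
Lemma lie_brE x y : lie_br (lie_pi x) (lie_pi y) = lie_pi (WBr x y).
Proof. by apply/lie_piP/cong_br; apply: lie_repr. Qed.

Lemma lie_piW (P : lie_alg -> Prop) : (forall x, P (lie_pi x)) -> forall x, P x.
Proof. by move=> PP; elim/quotW. Qed.

Lemma lie_addA : associative lie_add.
Proof.
elim/lie_piW=> x; elim/lie_piW=> y; elim/lie_piW=> z.
by rewrite !lie_addE; apply/lie_piP/cong_addA.
Qed.
Lemma lie_addC : commutative lie_add.
Proof.
by elim/lie_piW=> x; elim/lie_piW=> y; rewrite !lie_addE; apply/lie_piP/cong_addC.
Qed.
Lemma lie_add0 : left_id lie_zero lie_add.
Proof. by elim/lie_piW=> x; rewrite lie_addE; apply/lie_piP/cong_add0. Qed.
Lemma lie_addN : left_inverse lie_zero lie_opp lie_add.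
Proof. by elim/lie_piW=> x; rewrite lie_oppE lie_addE; apply/lie_piP/cong_addN. Qed.

HB.instance Definition _ :=
  GRing.isZmodule.Build lie_alg lie_addA lie_addC lie_add0 lie_addN.

Lemma lie_scaleA c d x : lie_scale c (lie_scale d x) = lie_scale (c * d) x.
Proof. by elim/lie_piW: x => x; rewrite !lie_scaleE; apply/lie_piP/cong_scaleA. Qed.
Lemma lie_scale1 : left_id 1 lie_scale.
Proof. by elim/lie_piW=> x; rewrite lie_scaleE; apply/lie_piP/cong_scale1. Qed.
Lemma lie_scaleDr : right_distributive lie_scale +%R.
Proof.
move=> c; elim/lie_piW=> x; elim/lie_piW=> y.
rewrite /GRing.add /= !(lie_addE, lie_scaleE); exact/lie_piP/cong_scaleDr.
Qed.
Lemma lie_scaleDl x : {morph lie_scale^~ x : c d / c + d}.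
Proof.
move=> c d; elim/lie_piW: x => x.
rewrite [RHS]/GRing.add /= !(lie_addE, lie_scaleE); exact/lie_piP/cong_scaleDl.
Qed.

HB.instance Definition _ := GRing.Zmodule_isLmodule.Build K lie_alg
  lie_scaleA lie_scale1 lie_scaleDr lie_scaleDl.

Definition lie_e (a : I) : lie_alg := lie_pi (WE a).
Definition lie_f (a : I) : lie_alg := lie_pi (WF a).
Definition lie_h (a : I) : lie_alg := lie_pi (WH a).

Definition lie_subalgebra (S : set lie_alg) : Prop :=
  subspace S /\ forall x y, S x -> S y -> S (lie_br x y).

Definition lie_cartan : set lie_alg := smallest (@subspace K lie_alg) (range lie_h).
Definition lie_nminus : set lie_alg := smallest lie_subalgebra (range lie_f).
Definition lie_bminus : set lie_alg :=
  [set x | exists y z, [/\ lie_nminus y, lie_cartan z & x = y + z]].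

End ChevalleySerre.

Section GradedSpaces.
Context (rR : realType) (V : vectType rR) (R : root_system V) (K : fieldType).
Local Notation X := (weight R).

Record graded_space := GradedSpace {
  gspace :> lmodType K;
  piece : X -> set gspace;
  piece_subspace : forall mu, subspace (piece mu);
  piece_sum : forall m : gspace, exists (s : seq X) (c : X -> gspace),
    (forall mu, piece mu (c mu)) /\ m = \sum_(mu <- s) c mu;
  piece_direct : forall (s : seq X) (c : X -> gspace), uniq s ->
    (forall mu, piece mu (c mu)) -> \sum_(mu <- s) c mu = 0 ->
    forall mu, mu \in s -> c mu = 0
}.

Definition homogeneous (M : graded_space) (d : X) (f : M -> M) : Prop :=
  forall mu m, piece mu m -> piece (mu + d) (f m).

(* A subspace is graded iff it is spanned by its homogeneous elements. *)
Definition graded_subspace (M : graded_space) (A : set M) : Prop :=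
  subspace A /\ A `<=` smallest (@subspace K M) (\bigcup_mu (A `&` piece mu)).

End GradedSpaces.

Section HRForms.
Context (rR : realType) (V : vectType rR) (R : root_system V)
  (Pi : root_basis R) (K : fieldType) (M : graded_space R K).
Context (F : simple Pi -> {linear M -> M}).

Definition M_closed (I : set (weight R)) : set M :=
  span_stable setT F (\bigcup_(mu in I) piece mu).

Definition nondegenerate_on (A : set M) (B : {biscalar M}) : Prop :=
  forall u, A u -> (forall v, A v -> B u v = 0) -> u = 0.

Record is_HR_form (B : {biscalar M}) : Prop := IsHRForm {
  HR_sym : forall u v, B u v = B v u;
  HR_nondeg : nondegenerate_on setT B;
  HR_orth : forall mu nu u v, mu != nu -> piece mu u -> piece nu v -> B u v = 0;
  HR_closed : forall I, closed_weights Pi I -> nondegenerate_on (M_closed I) B;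
  HR_comm : exists E : simple Pi -> {linear M -> M},
    [/\ forall a u v, B (E a u) v = B u (F a v),
        forall a mu u, piece mu u ->
          E a (F a u) - F a (E a u) = (pairing R mu (val a))%:~R *: u
      & forall a b u, a != b -> E a (F b u) - F b (E a u) = 0]
}.

End HRForms.

Section GradedRepresentations.
Context (rR : realType) (V : vectType rR) (R : root_system V)
  (Pi : root_basis R) (K : fieldType).

Definition g_alg : lmodType K :=
  lie_alg K (fun a b : simple Pi => pairing R (val b) (val a)).
Definition g_br : g_alg -> g_alg -> g_alg := @lie_br _ _ _.
Definition g_e : simple Pi -> g_alg := @lie_e _ _ _.
Definition g_f : simple Pi -> g_alg := @lie_f _ _ _.
Definition g_h : simple Pi -> g_alg := @lie_h _ _ _.
Definition g_bminus : set g_alg := @lie_bminus _ _ _.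

(* U(b^-)-submodules are the subspaces stable under b^-. *)
Record is_graded_rep (M : graded_space R K) (rho : {bilinear g_alg -> M -> M}) :
  Prop := IsGradedRep {
  rep_br : forall x y m, rho (g_br x y) m = rho x (rho y m) - rho y (rho x m);
  rep_e : forall a, homogeneous (simple_weight a) (rho (g_e a));
  rep_f : forall a, homogeneous (- simple_weight a) (rho (g_f a));
  rep_h : forall a mu m, piece mu m ->
    rho (g_h a) m = (pairing R mu (val a))%:~R *: m;
  rep_fg : exists T : set M, finite_set T /\ span_stable g_bminus rho T = setT
}.

Record graded_rep := GradedRep {
  rep_space :> graded_space R K;
  rep_act : {bilinear g_alg -> rep_space -> rep_space};
  rep_ok : is_graded_rep rep_act
}.

Definition subrep (M : graded_rep) (A : set M) : Prop :=
  graded_subspace A /\ stable_subspace setT (rep_act M) A.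

Definition irreducible_rep (M : graded_rep) : Prop :=
  (exists m : M, m != 0) /\
  forall A : set M, subrep A -> A = [set 0] \/ A = setT.

Definition has_highest_weight (M : graded_rep) (lambda : weight R) : Prop :=
  exists v : M, [/\ v != 0, piece lambda v, forall a, rep_act M (g_e a) v = 0
    & span_stable setT (rep_act M) [set v] = setT].

Definition is_L (lambda : weight R) (M : graded_rep) : Prop :=
  irreducible_rep M /\ has_highest_weight M lambda.

(* The direct sum of the [N i] has carrier [forall i, N i], with the
   componentwise structure; the inverse of a grading-preserving bijective
   homomorphism is again one. *)
Definition iso_direct_sum (M : graded_rep) (n : nat) (N : 'I_n -> graded_rep) :
  Prop := exists phi : (forall i, N i) -> M,
  [/\ forall (c : K) u v, phi (fun i => c *: u i + v i) = c *: phi u + phi v,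
      bijective phi,
      forall mu u, (forall i, piece mu (u i)) -> piece mu (phi u)
    & forall x u, phi (fun i => rep_act (N i) x (u i)) = rep_act M x (phi u)].

Definition semisimple_rep (M : graded_rep) : Prop :=
  exists (n : nat) (N : 'I_n -> graded_rep) (lambda : 'I_n -> weight R),
    (forall i, is_L (lambda i) (N i)) /\ iso_direct_sum M N.

End GradedRepresentations.

(* Main.v *)
From HB Require Import structures.
Require Import Defs.
From mathcomp Require Import all_boot all_order all_algebra.
From mathcomp Require Import sesquilinear.
From mathcomp Require Import all_classical all_reals.
From mathcomp Require Import ring lra zify.
Set Implicit Arguments.
Unset Strict Implicit.
Import Order.TTheory GRing.Theory Num.Theory.
Local Open Scope classical_set_scope.
Local Open Scope ring_scope.

(* Write [imF] for the sum of the images of the [F a] and [prim] for the common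
   kernel of the operators [E a].

   From an HR-form: applying the non-degeneracy on [M_I] to the closed set [I] of
   weights that are not below [mu] shows that the form is non-degenerate on
   [imF] in weight [mu], and weight spaces are finitely generated, so
   [M = prim + imF] with [prim] and [imF] meeting in 0. The Serre element in the
   [F a] commutes with every [E c] and has image in [imF]; as weights are bounded
   above, upward induction on weights shows that it vanishes. The Serre element
   in the [E a] is, up to sign, its adjoint. Homogeneous primitive vectors which
   form a basis of [M] modulo [imF] then generate irreducible submodules whose
   direct sum is [M].

   Conversely, every [L(lambda)] carries a contravariant form. Its graph is the
   submodule generated by the highest weight vectors in the product of
   [L(lambda)] and its dual, the latter twisted by the Chevalley involution. The
   sum of these forms is an HR-form because [M_I] is the sum of the components
   [L(lambda_i)] with [lambda_i] in [I]. *)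

(** * Roots and weights *)

Section RootData.
Context (rR : realType) (V : vectType rR) (R : root_system V)
  (Pi : root_basis R).
Local Notation X := (weight R).
Local Notation S := (simple Pi).

Lemma pairingE (mu : X) (a : S) :
  (pairing R mu (val a))%:~R = (coroot R (val a) (weight_val mu) : rR).
Proof.
apply/floorK; have /allP := valP mu; apply.
exact: (simple_sub (valP a)).
Qed.

Lemma weight_valD (mu nu : X) : weight_val (mu + nu) = weight_val mu + weight_val nu.
Proof. by []. Qed.

Lemma weight_valN (mu : X) : weight_val (- mu) = - weight_val mu.
Proof. by []. Qed.

Lemma pairingD (mu nu : X) (a : S) :
  pairing R (mu + nu) (val a) = pairing R mu (val a) + pairing R nu (val a).
Proof. by apply: (@intr_inj rR); rewrite pairingE weight_valD linearD rmorphD /= !pairingE. Qed.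

Lemma pairingN (mu : X) (a : S) : pairing R (- mu) (val a) = - pairing R mu (val a).
Proof. by apply: (@intr_inj rR); rewrite pairingE weight_valN linearN rmorphN /= !pairingE. Qed.

Definition cartan (a b : S) : int := pairing R (val b) (val a).

Lemma cartanE (a b : S) : (cartan a b)%:~R = (coroot R (val a) (val b) : rR).
Proof. exact: (pairingE (simple_weight b)). Qed.

Lemma cartan_diag (a : S) : cartan a a = 2.
Proof.
apply: (@intr_inj rR); rewrite cartanE coroot2 //; exact: (simple_sub (valP a)).
Qed.

Lemma simple_index (a : S) : (index (val a) (simple_roots Pi) < size (simple_roots Pi))%N.
Proof. by rewrite index_mem; exact: valP. Qed.

Definition simple_coord (a : S) (v : V) : rR :=
  coord (in_tuple (simple_roots Pi)) (Ordinal (simple_index a)) v.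

Fact simple_coord_linear a : scalar (simple_coord a).
Proof. by move=> c u v; rewrite /simple_coord linearP. Qed.
HB.instance Definition _ a :=
  GRing.isLinear.Build rR V rR *%R (simple_coord a) (simple_coord_linear a).

Lemma simple_coordZ a (c : rR) v : simple_coord a (c *: v) = c * simple_coord a v.
Proof. by rewrite linearZ. Qed.

Lemma simple_coordE (a b : S) : simple_coord a (val b) = (a == b)%:R.
Proof.
have fX : free (in_tuple (simple_roots Pi)) by apply/basis_free/(simple_basis Pi).
have bE : val b = (in_tuple (simple_roots Pi))`_(Ordinal (simple_index b)).
  by rewrite /= nth_index //; exact: valP.
rewrite /simple_coord bE coord_free // -val_eqE /= eq_sym.
congr (_ %:R); congr nat_of_bool; apply/eqP/eqP => [/(congr1 (nth 0 (simple_roots Pi)))|->//].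
by rewrite !nth_index; [move/val_inj | exact: valP | exact: valP].
Qed.

Lemma simple_coord_sum (a : S) (k : S -> nat) :
  simple_coord a (\sum_b val b *+ k b) = (k a)%:R.
Proof.
rewrite linear_sum (bigD1 a) //= big1 => [|b /negPf ba].
  by rewrite addr0 linearMn /= simple_coordE eqxx.
by rewrite linearMn /= simple_coordE eq_sym ba mul0rn.
Qed.

Lemma root_coord_sign (v : V) : v \in Defs.roots R ->
  (forall a, 0 <= simple_coord a v) \/ (forall a, simple_coord a v <= 0).
Proof.
move=> /(simple_sign Pi)[k [|]] ->; [left|right] => a.
  by rewrite simple_coord_sum.
by rewrite linearN /= simple_coord_sum oppr_le0.
Qed.

Lemma simple_root (a : S) : val a \in Defs.roots R.
Proof. exact/(simple_sub (valP a)). Qed.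

(* The simple reflection of [b] in [a] is a root whose [b]-coordinate is 1. *)
Lemma cartan_le0 (a b : S) : a != b -> cartan a b <= 0.
Proof.
move=> ab; have := roots_refl (simple_root a) (simple_root b).
rewrite -cartanE => /root_coord_sign[/(_ a)|/(_ b)];
  rewrite linearB /= simple_coordZ !simple_coordE !eqxx.
  by rewrite (negPf ab) mulr1 sub0r oppr_ge0 lerz0.
by rewrite eq_sym (negPf ab) mulr0 subr0 ler10.
Qed.

(* If [cartan a b = 0], reflecting [a] in [b] and then in [a] gives the root
   [- a - cartan b a *: b]. *)
Lemma cartan_eq0 (a b : S) : a != b -> cartan a b = 0 -> cartan b a = 0.
Proof.
move=> ab ab0; apply/eqP; rewrite eq_le cartan_le0 1?eq_sym //=.
have r1 := roots_refl (simple_root b) (simple_root a).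
have := roots_refl (simple_root a) r1.
have -> : coroot R (val a) (val a - (coroot R (val b) (val a) : rR) *: val b) = 2.
  by rewrite linearB linearZ /= -[X in _ - _ *: X]cartanE ab0 scaler0 subr0 coroot2 ?simple_root.
rewrite -cartanE.
move=> /root_coord_sign[/(_ a)|/(_ b)];
  rewrite !linearB /= !simple_coordZ !simple_coordE !eqxx.
  by rewrite (negPf ab) mulr0 subr0 mulr1n mulr1 => h; have : (0 : rR) <= 1 - 2 := h; rewrite subr_ge0 (ler_nat _ 2 1).
by rewrite eq_sym (negPf ab) mulr0 subr0 mulr1 sub0r oppr_le0 ler0z.
Qed.

(** Real-valued because the coordinates of a weight in the basis of simple roots need not be
    integers. *)
Definition height (v : V) : rR := \sum_a simple_coord a v.

Lemma heightD (u v : V) : height (u + v) = height u + height v.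
Proof. by rewrite /height -big_split /=; apply: eq_bigr => a _; rewrite linearD. Qed.

Lemma height_simple (a : S) : height (val a) = 1.
Proof.
rewrite /height (bigD1 a) //= simple_coordE eqxx big1 ?addr0 // => b /negPf ba.
by rewrite simple_coordE ba.
Qed.

Lemma weight_le_refl (mu : X) : weight_le Pi mu mu.
Proof.
by exists (fun=> 0); rewrite subrr big1.
Qed.

Lemma weight_le_trans (mu nu ka : X) :
  weight_le Pi mu nu -> weight_le Pi nu ka -> weight_le Pi mu ka.
Proof.
move=> [k kE] [l lE]; exists (fun a => k a + l a)%N.
have -> : ka - mu = nu - mu + (ka - nu) by rewrite [RHS]addrC addrA subrK.
by rewrite kE lE -big_split /=; apply: eq_bigr => a _; rewrite mulrnDr.
Qed.

Lemma weight_le_sub (mu : X) (a : S) : weight_le Pi (mu - simple_weight a) mu.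
Proof.
exists (fun b => nat_of_bool (b == a)); rewrite opprB addrC subrK.
by rewrite (bigD1 a) //= eqxx big1 ?addr0 // => b /negPf ->.
Qed.

Lemma weight_le_coord (mu nu : X) : weight_le Pi mu nu ->
  forall a, simple_coord a (weight_val mu) <= simple_coord a (weight_val nu).
Proof.
move=> [k kE] a; rewrite -subr_ge0 -linearB.
have -> : weight_val nu - weight_val mu = \sum_b val b *+ k b.
  rewrite -weight_valN -weight_valD kE (big_morph _ weight_valD (erefl : weight_val 0 = 0)).
  by apply: eq_bigr => b _; elim: (k b) => // n IH; rewrite !mulrS weight_valD IH.
by rewrite /= simple_coord_sum.
Qed.

Lemma weight_le_addN (mu : X) (a : S) : ~ weight_le Pi (mu + simple_weight a) mu.
Proof.
move=> /weight_le_coord/(_ a); rewrite weight_valD linearD /= simple_coordE eqxx mulr1n; lra.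
Qed.

(** Adding a simple root raises the height by exactly 1, so finitely many steps lead above [h]. In
    the applications the weight spaces above [h] vanish, which settles the base case. *)
Lemma weight_ind_up (h : rR) (P : X -> Prop) :
  (forall mu : X, h < height (weight_val mu) -> P mu) ->
  (forall mu, (forall a : S, P (mu + simple_weight a)) -> P mu) ->
  forall mu, P mu.
Proof.
move=> Ph Pup mu.
have [n] : exists n : nat, h - height (weight_val mu) < n%:R.
  exists (Num.bound `|h - height (weight_val mu)|).
  exact: le_lt_trans (ler_norm _) (archi_boundP (normr_ge0 _)).
elim: n mu => [|n IH] mu lt_n; first by apply: Ph; lra.
apply: Pup => a; apply: IH.
rewrite weight_valD heightD (height_simple a); move: lt_n; rewrite mulrS; lra.
Qed.

End RootData.

(** * Subspaces and graded spaces *)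

Section SubspaceTheory.
Context (K : fieldType) (M : lmodType K).
Implicit Type A : set M.

Lemma subspaceD A u v : subspace A -> A u -> A v -> A (u + v).
Proof. by move=> [_ Alin] Au Av; rewrite -[u]scale1r; apply: Alin. Qed.

Lemma subspaceZ A c u : subspace A -> A u -> A (c *: u).
Proof. by move=> [A0 Alin] Au; rewrite -[_ *: _]addr0; apply: Alin. Qed.

Lemma subspaceN A u : subspace A -> A u -> A (- u).
Proof. by move=> sA Au; rewrite -scaleN1r; apply: subspaceZ. Qed.

Lemma subspaceB A u v : subspace A -> A u -> A v -> A (u - v).
Proof. by move=> sA Au Av; apply: subspaceD => //; apply: subspaceN. Qed.

Lemma subspace_sum A (I : Type) (s : seq I) (P : pred I) (f : I -> M) :
  subspace A -> (forall i, P i -> A (f i)) -> A (\sum_(i <- s | P i) f i).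
Proof.
move=> sA Af; elim/big_ind: _ => //; first by case: sA.
by move=> u v; apply: subspaceD.
Qed.

Lemma subspace_preim (N : lmodType K) (f : {linear N -> M}) A :
  subspace A -> subspace (f @^-1` A).
Proof.
by move=> [A0 Alin]; split=> [|c u v Au Av] /=; rewrite ?linear0 // linearP; apply: Alin.
Qed.

Lemma subspace_eq (N : lmodType K) (f g : {linear M -> N}) :
  subspace [set m | f m = g m].
Proof. by split=> [|c u v uE vE] /=; rewrite ?linear0 // !linearP uE vE. Qed.

Section SpanStable.
Context (T : Type) (D : set T) (f : T -> M -> M) (G : set M).

Lemma span_stable_sub : G `<=` span_stable D f G.
Proof. by apply: sub_gen_smallest. Qed.

Lemma span_stable_stable : stable_subspace D f (span_stable D f G).
Proof.
split=> [|t m Dt Am A [sA GA]]; last by case: (sA) => _; apply=> //; apply: Am.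
split=> [A [[[A0 _] _] _]|c u v Au Av A [sA GA]] //.
by case: (sA) => -[_ Alin] _; apply: Alin; [apply: Au | apply: Av].
Qed.

Lemma span_stable_subspace : subspace (span_stable D f G).
Proof. by case: span_stable_stable. Qed.

Lemma span_stable_ind A : stable_subspace D f A -> G `<=` A -> span_stable D f G `<=` A.
Proof. exact: smallest_sub. Qed.

End SpanStable.

(** The linear span of [s]. Coefficients are indexed by positions, so that they can serve as rows
    and columns of matrices. *)
Definition comb (s : seq M) : set M :=
  [set m | exists c : 'I_(size s) -> K, m = \sum_i c i *: s`_i].

Lemma comb_subspace s : subspace (comb s).
Proof.
split=> [|k u v [c ->] [d ->]].
  by exists (fun=> 0); rewrite big1 // => i _; rewrite scale0r.
exists (fun i => k * c i + d i); rewrite scaler_sumr -big_split /=.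
by apply: eq_bigr => i _; rewrite scalerDl scalerA.
Qed.

Lemma mem_comb s m : m \in s -> comb s m.
Proof.
rewrite -index_mem => ms; exists (fun i => (i == Ordinal ms)%:R).
rewrite (bigD1 (Ordinal ms)) //= eqxx scale1r nth_index -?index_mem // big1 ?addr0 //.
by move=> i /negPf ->; rewrite scale0r.
Qed.

Lemma comb_sub s A : subspace A -> (forall m, m \in s -> A m) -> comb s `<=` A.
Proof.
move=> sA sA' m [c ->]; apply: subspace_sum => // i _; apply: subspaceZ => //.
by apply: sA'; apply: mem_nth.
Qed.

Lemma comb_mono (s t : seq M) : {subset s <= t} -> comb s `<=` comb t.
Proof.
by move=> st; apply: comb_sub; [exact: comb_subspace | move=> m /st; apply: mem_comb].
Qed.

End SubspaceTheory.

Lemma big_supp (I : eqType) (M : zmodType) (q r : seq I) (e : I -> M) :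
  uniq q -> uniq r -> {subset q <= r} -> (forall i, i \notin q -> e i = 0) ->
  \sum_(i <- r) e i = \sum_(i <- q) e i.
Proof.
move=> uq ur qr e0; rewrite (bigID (mem q)) /= [X in _ + X]big1 // addr0 -big_filter.
apply/perm_big/uniq_perm; rewrite ?filter_uniq // => i.
by rewrite mem_filter; apply/andP/idP => [[]|iq] //; split=> //; apply: qr.
Qed.

(** * Projections onto the weight spaces of a graded space *)

Section Projections.
Context (rR : realType) (V : vectType rR) (R : root_system V) (K : fieldType)
  (M : graded_space R K).
Local Notation X := (weight R).
Implicit Types (mu nu : X) (m : M).

Fact decomp m : exists d : X -> M, (forall mu, piece mu (d mu)) /\
  exists s : seq X, [/\ uniq s, forall mu, mu \notin s -> d mu = 0
    & m = \sum_(mu <- s) d mu].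
Proof.
have [s [c [cP ->]]] := piece_sum m.
(* The sequence [s] may have repetitions, so the component at [mu] is [c mu] taken with its
   multiplicity in [s]. *)
exists (fun mu => if mu \in s then c mu *+ count_mem mu s else 0); split=> [mu|].
  case: ifP => _; last by case: (piece_subspace M mu).
  by rewrite -scaler_nat; apply: subspaceZ => //; exact: piece_subspace.
exists (undup s); split; first exact: undup_uniq.
  by move=> mu; rewrite mem_undup => /negPf ->.
rewrite -big_undup_iterop_count big_seq [RHS]big_seq; apply: eq_bigr => mu.
rewrite mem_undup => ->; rewrite Monoid.iteropE.
by elim: (count_mem _ _) => //= n ->; rewrite mulrS.
Qed.

(** A choice of components for each vector separately; [pr_unique] shows that the choice is forced,
    and linearity follows from this. *)
Definition pr mu m : M := projT1 (cid (decomp m)) mu.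

Lemma pr_piece mu m : piece mu (pr mu m).
Proof. by rewrite /pr; case: cid => d []. Qed.

Lemma pr_sum m : exists s : seq X, [/\ uniq s,
  forall mu, mu \notin s -> pr mu m = 0 & m = \sum_(mu <- s) pr mu m].
Proof. by rewrite /pr; case: cid => d []. Qed.

Lemma pr_unique m (d : X -> M) (s : seq X) : (forall mu, piece mu (d mu)) -> uniq s ->
  (forall mu, mu \notin s -> d mu = 0) -> m = \sum_(mu <- s) d mu ->
  forall mu, pr mu m = d mu.
Proof.
move=> dP us ds mE mu; have [t [ut prt mE']] := pr_sum m.
(* Directness applies to the difference of the two decompositions once both are written over the
   union of their supports. *)
pose r := undup (s ++ t).
have sr : {subset s <= r} by move=> nu nus; rewrite mem_undup mem_cat nus.
have tr : {subset t <= r} by move=> nu nut; rewrite mem_undup mem_cat nut orbT.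
have [mur|] := boolP (mu \in r); last first.
  by rewrite mem_undup mem_cat negb_or => /andP[/ds -> /prt ->].
apply/eqP; rewrite -subr_eq0; apply/eqP.
apply: (@piece_direct _ _ _ _ M r (fun nu => pr nu m - d nu)) => //.
- exact: undup_uniq.
- by move=> nu; apply: subspaceB; [exact: piece_subspace | exact: pr_piece | exact: dP].
by rewrite sumrB (big_supp ut (undup_uniq _)) // (big_supp us (undup_uniq (s ++ t))) // -mE' -mE subrr.
Qed.

Fact pr_linear mu : linear (pr mu).
Proof.
move=> c u v; have [s [us prs uE]] := pr_sum u; have [t [ut prt vE]] := pr_sum v.
pose r := undup (s ++ t).
apply: (@pr_unique _ (fun nu => c *: pr nu u + pr nu v) r) => [nu||nu|].
- by case: (piece_subspace M nu) => _; apply; exact: pr_piece.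
- exact: undup_uniq.
- by rewrite mem_undup mem_cat negb_or => /andP[/prs -> /prt ->]; rewrite scaler0 addr0.
rewrite big_split /= -scaler_sumr (big_supp us (undup_uniq _)) //.
  rewrite (big_supp ut (undup_uniq (s ++ t))) -?uE -?vE // => nu nut.
  by rewrite mem_undup mem_cat nut orbT.
by move=> nu nus; rewrite mem_undup mem_cat nus.
Qed.
HB.instance Definition _ mu := GRing.isLinear.Build K M M _ (pr mu) (pr_linear mu).

Lemma pr_piece_nat mu nu m : piece nu m -> pr mu m = if mu == nu then m else 0.
Proof.
move=> mP; apply: (@pr_unique _ (fun mu => if mu == nu then m else 0) [:: nu]) => //.
- by move=> ka; case: eqP => [->|_] //; case: (piece_subspace M ka).
- by move=> ka; rewrite inE => /negPf ->.
- by rewrite big_seq1 eqxx.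
Qed.

Lemma pr_id mu m : piece mu m -> pr mu m = m.
Proof. by move=> /pr_piece_nat ->; rewrite eqxx. Qed.

Lemma pr_pr mu nu m : pr mu (pr nu m) = if mu == nu then pr nu m else 0.
Proof. exact/pr_piece_nat/pr_piece. Qed.

Lemma pr_eq0 m : (forall mu, pr mu m = 0) -> m = 0.
Proof. by move=> m0; have [s [_ _ ->]] := pr_sum m; rewrite big1. Qed.

Lemma eq_pr u v : (forall mu, pr mu u = pr mu v) -> u = v.
Proof.
move=> uv; apply/eqP; rewrite -subr_eq0; apply/eqP/pr_eq0 => mu.
by rewrite linearB /= uv subrr.
Qed.

Lemma subspace_pr (A : set M) m : subspace A -> (forall mu, A (pr mu m)) -> A m.
Proof. by move=> sA Am; have [s [_ _ ->]] := pr_sum m; apply: subspace_sum. Qed.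

Lemma piece_ind (A : set M) : subspace A -> (forall mu m, piece mu m -> A m) -> forall m, A m.
Proof. by move=> sA Ap m; apply: subspace_pr => // mu; apply/Ap/pr_piece. Qed.

Lemma pr_homogeneous d (f : {linear M -> M}) mu m :
  homogeneous d f -> pr mu (f m) = f (pr (mu - d) m).
Proof.
move=> fd; apply: (@piece_ind [set m | pr mu (f m) = f (pr (mu - d) m)]) => {m} [|nu m mP] /=.
  by split=> [|c u v /= uE vE] /=; rewrite ?linear0 // !linearP /= uE vE.
rewrite (pr_piece_nat _ (fd _ _ mP)) (pr_piece_nat _ mP) subr_eq.
by case: eqP => // _; rewrite linear0.
Qed.

Definition graded_set (A : set M) := forall mu m, A m -> A (pr mu m).

(** Stability under the projections is the form of gradedness in which all later verifications take
    place. *)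
Lemma graded_subspace_pr (A : set M) :
  graded_subspace A <-> subspace A /\ graded_set A.
Proof.
split=> [[sA Agr]|[sA Agr]]; split=> //.
  move=> mu m /Agr; move: m.
  suff: smallest (@subspace K M) (\bigcup_mu (A `&` piece mu)) `<=` (pr mu) @^-1` A by [].
  apply: smallest_sub; first exact: subspace_preim.
  by move=> m [nu _ [Am mP]] /=; rewrite (pr_piece_nat _ mP); case: ifP => // _; case: sA.
move=> m Am B [sB AB]; apply: subspace_pr => // mu.
by apply: AB; exists mu => //; split; [exact: Agr | exact: pr_piece].
Qed.

End Projections.

(** * Operators satisfying the Chevalley relations *)

Section Ad.
Context (K : fieldType) (M : lmodType K).
Implicit Types f g : {linear M -> M}.

Definition ad f g : {linear M -> M} := (f \o g) \- (g \o f).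

Lemma adE f g m : ad f g m = f (g m) - g (f m). Proof. by []. Qed.

(** The Jacobi identity in the form that [ad e] is a derivation of the commutator; the inductions on
    iterated brackets rest on it. *)
Lemma ad_jacobi e f g m : ad e (ad f g) m = ad (ad e f) g m + ad f (ad e g) m.
Proof.
have zmod (x1 x2 x3 x4 y z : M) :
    x1 - x2 - (x3 - x4) = x1 - y - (z - x4) + (y - x3 - (x2 - z)).
  rewrite [RHS]addrACA subrKA -opprD [z - x4 + _]addrC subrKA !opprB.
  by rewrite [LHS]addrACA [RHS]addrACA [X in _ + X]addrC.
by rewrite !adE !linearB /= -!opprD; apply: zmod.
Qed.

Lemma ad_scalel f f' g c : (forall m, f m = c *: f' m) ->
  forall m, ad f g m = c *: ad f' g m.
Proof. by move=> fE m; rewrite !adE !fE linearZ scalerBr. Qed.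

Lemma ad_scaler f g g' c : (forall m, g m = c *: g' m) ->
  forall m, ad f g m = c *: ad f g' m.
Proof. by move=> gE m; rewrite !adE !gE linearZ scalerBr. Qed.

Lemma ad_jacobi_cyc e f g m :
  ad e (ad f g) m + (ad f (ad g e) m + ad g (ad e f) m) = 0.
Proof.
have anti u v x : ad u v x = -1 *: ad v u x by rewrite scaleN1r !adE opprB.
rewrite ad_jacobi (ad_scaler _ (anti g e)) (anti g) !scaleN1r.
by rewrite -opprD [X in _ - X]addrC subrr.
Qed.

Lemma ad0l f g : (forall m, f m = 0) -> forall m, ad f g m = 0.
Proof. by move=> f0 m; rewrite adE !f0 linear0 subrr. Qed.

Lemma ad0r f g : (forall m, g m = 0) -> forall m, ad f g m = 0.
Proof. by move=> g0 m; rewrite adE !g0 linear0 subrr. Qed.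

End Ad.

(** * Graded operators with the Chevalley relations, without the Serre relations *)

Section Chevalley.
Context (rR : realType) (V : vectType rR) (R : root_system V)
  (Pi : root_basis R) (K : fieldType) (M : graded_space R K).
Local Notation X := (weight R).
Local Notation S := (simple Pi).

(** The Cartan elements are represented by the commutators of [E a] and [F a]. No Serre relation is
    demanded: these are to be derived. *)
Record chevalley_ops (E F : S -> {linear M -> M}) : Prop := ChevalleyOps {
  chev_E : forall a, homogeneous (simple_weight a) (E a);
  chev_F : forall a, homogeneous (- simple_weight a) (F a);
  chev_H : forall a mu m, piece mu m ->
    ad (E a) (F a) m = (pairing R mu (val a))%:~R *: m;
  chev_EF : forall a b m, a != b -> ad (E a) (F b) m = 0
}.

Context (E F : S -> {linear M -> M}).

Definition imF : set M := [set m | exists g : S -> M, m = \sum_a F a (g a)].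
Definition prim : set M := [set m | forall a, E a m = 0].
Definition bounded_above (h : rR) := forall (mu : X) (m : M),
  piece mu m -> h < height Pi (weight_val mu) -> m = 0.

Lemma imF_subspace : subspace imF.
Proof.
split=> [|c u v [g ->] [g' ->]]; first by exists (fun=> 0); rewrite big1 // => a _; rewrite linear0.
exists (fun a => c *: g a + g' a); rewrite scaler_sumr -big_split /=.
by apply: eq_bigr => a _; rewrite linearP.
Qed.

Lemma imF_F a m : imF (F a m).
Proof.
exists (fun b => if b == a then m else 0).
by rewrite (bigD1 a) //= eqxx big1 ?addr0 // => b /negPf ->; rewrite linear0.
Qed.

Lemma prim_subspace : subspace prim.
Proof. by split=> [a|c u v pu pv a]; rewrite ?linear0 // linearP pu pv scaler0 addr0. Qed.

Hypothesis EF : chevalley_ops E F.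

Definition opH a : {linear M -> M} := ad (E a) (F a).

Lemma EF_comm a b m : E a (F b m) = F b (E a m) + (if a == b then opH a m else 0).
Proof.
case: eqP => [<-|/eqP /(chev_EF EF m)]; first by rewrite adE addrC subrK.
by rewrite adE addr0 => /eqP; rewrite subr_eq0 => /eqP.
Qed.

Lemma pr_E mu a m : pr mu (E a m) = E a (pr (mu - simple_weight a) m).
Proof. exact: (pr_homogeneous _ _ (chev_E EF a)). Qed.

Lemma pr_F mu a m : pr mu (F a m) = F a (pr (mu + simple_weight a) m).
Proof. by rewrite (pr_homogeneous _ _ (chev_F EF a)) opprK. Qed.

Lemma pr_opH mu a m : pr mu (opH a m) = (pairing R mu (val a))%:~R *: pr mu m.
Proof.
rewrite /opH adE linearB /= pr_E pr_F pr_F pr_E addrK subrK -adE.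
exact/(chev_H EF)/pr_piece.
Qed.

(** In each weight [opH a] acts as a scalar, and the scalars before and after applying [F b] differ
    by [cartan a b]. *)
Lemma opH_F a b m : ad (opH a) (F b) m = - (cartan a b)%:~R *: F b m.
Proof.
apply: eq_pr => mu; rewrite adE linearB linearZ /= pr_opH !pr_F pr_opH.
by rewrite pairingD linearZ /= rmorphD /= scalerDl opprD addNKr scaleNr.
Qed.

Lemma opH_E a b m : ad (opH a) (E b) m = (cartan a b)%:~R *: E b m.
Proof.
apply: eq_pr => mu; rewrite adE linearB linearZ /= pr_opH !pr_E pr_opH.
by rewrite pairingD pairingN linearZ /= rmorphB /= scalerBl opprB addrC subrK.
Qed.

Lemma opH_opH a b m : ad (opH a) (opH b) m = 0.
Proof.
apply: eq_pr => mu; rewrite adE linearB /= !pr_opH linear0 !scalerA.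
by rewrite [X in X *: _ - _]mulrC subrr.
Qed.

Lemma graded_prim : graded_set prim.
Proof.
by move=> mu m pm a; rewrite -[mu](addrK (simple_weight a)) -pr_E pm linear0.
Qed.

Lemma graded_imF : graded_set imF.
Proof.
move=> mu _ [g ->]; rewrite linear_sum.
by apply: subspace_sum => [|a _]; [exact: imF_subspace | rewrite /= pr_F; exact: imF_F].
Qed.

(** Upward induction on weights: the vectors [E a m] lie in higher weight spaces, which are already
    known to be contained in [A]. *)
Lemma piece_ind_up h (A : set M) : bounded_above h -> subspace A ->
  (forall mu m, piece mu m -> (forall a, A (E a m)) -> A m) -> forall m, A m.
Proof.
move=> bM sA Aup; apply: piece_ind => // mu.
elim/(@weight_ind_up _ _ _ Pi h): mu => [mu hmu|mu IH] m mP.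
  by rewrite (bM _ _ mP hmu); case: sA.
by apply: (Aup _ _ mP) => a; apply: (IH a); exact: (chev_E EF a mP).
Qed.

(** * The Serre elements in the lowering operators *)

Section Serre.
Context (a b : S).
Hypothesis ab : a != b.
Let A := cartan a b.

Definition serreF (n : nat) : {linear M -> M} := iter n (ad (F a)) (F b).

Lemma opH_serreF n m :
  ad (opH a) (serreF n) m = - (n%:Z * 2 + A)%:~R *: serreF n m.
Proof.
elim: n m => [|n IH] m; first by rewrite mul0r add0r opH_F.
rewrite [LHS]ad_jacobi (ad_scalel _ (opH_F a a)) (ad_scaler _ IH) cartan_diag -scalerDl.
by congr (_ *: _); rewrite -opprD -rmorphD /=; congr (- _%:~R); rewrite intS; ring.
Qed.

(** The usual sl2 formula: for the adjoint action of [E a] and [F a], the operator [F b] is a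
    highest weight vector of weight [- A], because [E a] commutes with it. *)
Lemma E_serreF n m : ad (E a) (serreF n.+1) m = - (n.+1%:Z * (n%:Z + A))%:~R *: serreF n m.
Proof.
elim: n m => [|n IH] m; rewrite [LHS]ad_jacobi.
  rewrite [X in X + _](opH_serreF 0) [X in _ + X](ad0r _ (fun m => chev_EF EF m ab)) addr0.
  by rewrite mul0r mul1r.
rewrite [X in X + _](opH_serreF n.+1) (ad_scaler _ IH) -scalerDl; congr (_ *: _).
by rewrite -opprD -rmorphD /=; congr (- _%:~R); rewrite !intS; ring.
Qed.

(** Since [E b] commutes with [F a], it only meets the innermost [F b] and turns it into [opH b].
    The first bracket with [F a] gives a multiple of [F a], the second gives 0. *)
Lemma Eb_serreF n m : ad (E b) (serreF n.+2) m = 0.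
Proof.
have ba : b != a by rewrite eq_sym.
have FE : forall m, ad (E b) (F a) m = 0 by move=> *; exact: (chev_EF EF).
have serre1 m' : ad (E b) (serreF 1) m' = (cartan b a)%:~R *: F a m'.
  rewrite [LHS]ad_jacobi (ad0l _ FE) add0r adE -opprB -[X in - X]/(ad (opH b) (F a) m').
  by rewrite opH_F scaleNr opprK.
elim: n m => [|n IH] m; rewrite [LHS]ad_jacobi (ad0l _ FE) add0r; last exact: ad0r.
by rewrite (ad_scaler _ serre1) adE subrr scaler0.
Qed.

Lemma Ec_serreF c n m : c != a -> c != b -> ad (E c) (serreF n) m = 0.
Proof.
move=> ca cb; elim: n m => [|n IH] m; first exact: (chev_EF EF).
rewrite [LHS]ad_jacobi (ad0r _ IH) addr0.
by apply: ad0l => ?; exact: (chev_EF EF).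
Qed.

Lemma serreF_comm c m : ad (E c) (serreF `|1 - A|%N) m = 0.
Proof.
have A0 : A <= 0 by exact: cartan_le0.
have [-> {c}|ca] := eqVneq c a.
  have -> : `|1 - A|%N = `|A|%N.+1 by lia.
  by rewrite E_serreF (_ : _ + A = 0) ?mulr0 ?oppr0 ?scale0r //; lia.
have [-> {c ca}|cb] := eqVneq c b; last exact: Ec_serreF.
(* For [A = 0] there is only one bracket with [F a], so [Eb_serreF] does not apply; here the
   multiple of [F a] that remains has coefficient [cartan b a = 0]. *)
have [A_eq0|A_neq0] := eqVneq A 0.
  have ba : b != a by rewrite eq_sym.
  rewrite A_eq0 /= [LHS]ad_jacobi ad0l => [|?]; last exact: (chev_EF EF).
  rewrite add0r adE -opprB -[X in - X]/(ad (opH b) (F a) m) opH_F.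
  by rewrite cartan_eq0 // oppr0 scale0r oppr0.
have -> : `|1 - A|%N = `|A|.-1%N.+2 by lia.
exact: Eb_serreF.
Qed.

Lemma imF_serreF n m : imF (serreF n m).
Proof.
elim: n m => [|n IH] m; first exact: imF_F.
by rewrite [serreF _ _]adE; apply: subspaceB; [exact: imF_subspace|exact: imF_F|exact: IH].
Qed.

(** If the Serre element kills every [E c m], then its value at [m] is primitive, because it
    commutes with each [E c]. The value also lies in [imF], hence is 0. *)
Lemma serreF_eq0 h : bounded_above h -> prim `&` imF `<=` [set 0] ->
  forall m, serreF `|1 - A|%N m = 0.
Proof.
move=> bM pi0; apply: (piece_ind_up bM) => [|mu m mP th0] /=.
  by split=> [|c u v /= u0 v0] /=; rewrite ?linear0 // linearP u0 v0 scaler0 addr0.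
apply: pi0; split; last exact: imF_serreF.
move=> c; have := serreF_comm c m; rewrite adE => /eqP; rewrite subr_eq0 => /eqP ->.
exact: th0.
Qed.

End Serre.

End Chevalley.

(** * Consequences of an HR-form *)

Section FiniteGeneration.
Context (rR : realType) (V : vectType rR) (R : root_system V)
  (Pi : root_basis R) (K : fieldType) (M : graded_space R K).
Local Notation X := (weight R).
Local Notation S := (simple Pi).

Lemma comb_map (N L : lmodType K) (f : {linear N -> L}) (s : seq N) u :
  comb s u -> comb (map f s) (f u).
Proof.
move: u; suff: comb s `<=` f @^-1` comb (map f s) by [].
apply: comb_sub => [|m ms]; first exact/subspace_preim/comb_subspace.
exact/mem_comb/map_f.
Qed.

Lemma seq_bound (I : eqType) (s : seq I) (P : I -> rR -> Prop) :
  (forall i, i \in s -> exists h, forall h', h <= h' -> P i h') ->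
  exists h, forall h', h <= h' -> forall i, i \in s -> P i h'.
Proof.
elim: s => [|i s IH] Ps; first by exists 0.
have [h1 Ph1] := Ps _ (mem_head i s).
have [|h2 Ph2] := IH; first by move=> j js; apply: Ps; rewrite inE js orbT.
exists (Num.max h1 h2) => h'; rewrite ge_max => /andP[le1 le2] j.
by rewrite inE => /orP[/eqP ->|]; [exact: Ph1 | exact: Ph2].
Qed.

Context (F : S -> {linear M -> M}) (s : seq M).
Hypothesis Fd : forall a, homogeneous (- simple_weight a) (F a).
Hypothesis Fs : span_stable setT F [set` s] = setT.

Lemma pr_lower mu a m : pr mu (F a m) = F a (pr (mu + simple_weight a) m).
Proof. by rewrite (pr_homogeneous _ _ (Fd a)) opprK. Qed.

(** The sum of [comb s] and [imF] contains the generators and absorbs every [F a], so it is all of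
    [M]. *)
Lemma comb_imF m : exists u v, [/\ comb s u, imF F v & m = u + v].
Proof.
have : span_stable setT F [set` s] m by rewrite Fs.
move: m; apply: span_stable_ind => [|m ms]; last first.
  by exists m, 0; split; [exact: mem_comb | case: (imF_subspace F) | rewrite addr0].
split=> [|a m _ _]; last first.
  by exists 0, (F a m); split; [case: (comb_subspace s) | exact: imF_F | rewrite add0r].
split=> [|c m m' [u [v [us vF ->]]] [u' [v' [us' vF' ->]]]].
  by exists 0, 0; split; [case: (comb_subspace s) | case: (imF_subspace F) | rewrite addr0].
exists (c *: u + u'), (c *: v + v'); split; last by rewrite scalerDr addrACA.
  by case: (comb_subspace s) => _; apply.
by case: (imF_subspace F) => _; apply.
Qed.

(** The generators have finitely many weights in total, and the operators [F a] only lower the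
    height. *)
Lemma fg_bounded : exists h, bounded_above Pi M h.
Proof.
have [|h hs] := @seq_bound _ s (fun m h => forall mu : X,
    h < height Pi (weight_val mu) -> pr mu m = 0).
  move=> m _; have [t [_ mt _]] := pr_sum m.
  have [|h ht] := @seq_bound _ t (fun mu h => height Pi (weight_val mu) <= h).
    by move=> mu _; exists (height Pi (weight_val mu)).
  exists h => h' hh' mu h'mu; apply: mt; apply/negP => /(ht _ hh').
  by rewrite leNgt h'mu.
exists h => mu m mP hmu; rewrite -(pr_id mP).
have : span_stable setT F [set` s] m by rewrite Fs.
suff: span_stable setT F [set` s] `<=`
    [set m | forall mu : X, h < height Pi (weight_val mu) -> pr mu m = 0].
  by move=> /[apply]; apply.
apply: span_stable_ind => [|m' ms nu]; last exact: hs.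
split=> [|a m' _ m0 nu hnu] /=; last first.
  rewrite pr_lower m0 ?linear0 // weight_valD heightD (height_simple a).
  by rewrite (lt_trans hnu) // ltrDl ltr01.
split=> [nu _|c u v u0 v0 nu hnu] /=; first by rewrite linear0.
by rewrite linearP /= u0 // v0 // scaler0 addr0.
Qed.

(** Upward induction: the weight space of [mu] is spanned by the projections of the generators and
    by the images under [F a] of the weight spaces of [mu + simple_weight a]. *)
Lemma piece_fg mu : exists t : seq M, piece mu `<=` comb t.
Proof.
have [h bM] := fg_bounded.
elim/(@weight_ind_up _ _ _ Pi h): mu => [mu hmu|mu IH].
  exists [::] => m mP; rewrite (bM _ _ mP hmu).
  by case: (comb_subspace ([::] : seq M)).
have [t tP] := choice IH.
exists (map (pr mu) s ++ flatten [seq map (F a) (t a) | a <- enum {: S}]) => m mP.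
rewrite -(pr_id mP); have [u [_ [us [g ->] ->]]] := comb_imF m.
rewrite linearD linear_sum; apply: subspaceD; first exact: comb_subspace.
  apply: (comb_mono (s := map (pr mu) s)) => [x xs|]; first by rewrite mem_cat xs.
  exact: comb_map.
apply: subspace_sum => [|a _] /=; first exact: comb_subspace.
rewrite pr_lower; apply: (comb_mono (s := map (F a) (t a))) => [x xs|].
  rewrite mem_cat; apply/orP; right; apply/flattenP.
  by exists (map (F a) (t a)) => //; apply: map_f; rewrite mem_enum.
by apply: comb_map; apply: tP; exact: pr_piece.
Qed.

(** Provides the finite spanning sequence to which [orthogonal_split] is applied. *)
Lemma imF_piece_fg mu : exists t : seq M,
  forall m, comb t m <-> imF F m /\ piece mu m.
Proof.
have [t tP] := @choice S (seq M)
  (fun a t => piece (mu + simple_weight a) `<=` comb t) (fun a => piece_fg _).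
(* The entries of [t a] need not be homogeneous; projecting them first puts their images under [F a]
   in weight [mu]. *)
pose t' := flatten [seq map (F a) (map (pr (mu + simple_weight a)) (t a)) | a <- enum {: S}].
exists t' => m; split.
  move: m; suff : comb t' `<=` imF F `&` piece mu by [].
  apply: comb_sub.
    have [i0 iP] := imF_subspace F; have [p0 pP] := piece_subspace M mu.
    by split=> [//|c u v [iu pu] [iv pv]]; split; [exact: iP | exact: pP].
  move=> m /flattenP[_ /mapP[a _ ->] /mapP[x /mapP[y _ ->] ->]].
  split; first exact: imF_F.
  by rewrite -pr_lower; exact: pr_piece.
move=> [[g mE] mP]; rewrite -(pr_id mP) mE linear_sum.
apply: subspace_sum => [|a _] /=; first exact: comb_subspace.
rewrite pr_lower.
apply: (comb_mono (s := map (F a) (map (pr (mu + simple_weight a)) (t a)))) => [x xs|].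
  by apply/flattenP; exists (map (F a) (map (pr (mu + simple_weight a)) (t a))) => //;
    apply/mapP; exists a => //; rewrite mem_enum.
rewrite -(pr_id (pr_piece _ (g a))); do 2!apply: comb_map.
by apply: tP; exact: pr_piece.
Qed.

End FiniteGeneration.

(** The coefficients of the projection of [m] solve a linear system with the Gram matrix [G] of [t].
    As [t] may be dependent, [G] may be singular; the system is solvable because its right-hand side
    is killed by the cokernel of [G]. *)
Lemma orthogonal_split (K : fieldType) (M : lmodType K) (B : {biscalar M}) (t : seq M) :
  (forall u, comb t u -> (forall v, comb t v -> B v u = 0) -> u = 0) ->
  forall m, exists2 a, comb t a & forall v, comb t v -> B (m - a) v = 0.
Proof.
move=> Bt m.
pose G := \matrix_(i < size t, j < size t) B t`_i t`_j.
have GE i j : G i j = B t`_i t`_j by rewrite /G mxE.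
pose b := \row_(j < size t) B m t`_j.
have bE j : b 0 j = B m t`_j by rewrite /b mxE.
have : (b <= G)%MS.
  rewrite submxE; apply/eqP/rowP => j; rewrite [RHS]mxE.
  (* A column of the cokernel gives a vector [w] orthogonal to the span of [t], so [w = 0] and hence
     [B m w = 0]. *)
  pose w := \sum_i cokermx G i j *: t`_i.
  have Bw u : B u w = \sum_(i < size t) B u t`_i * cokermx G i j.
    by rewrite linear_sumr; apply: eq_bigr => i _; rewrite linearZr mulrC.
  have w0 : w = 0.
    apply: Bt => [|_ [c ->]]; first by exists (cokermx G ^~ j).
    rewrite linear_sumlz big1 // => i _; rewrite linearZl /= Bw.
    have /matrixP/(_ i j) := mulmx_coker G; rewrite !mxE => G0.
    rewrite (eq_bigr (fun k => G i k * cokermx G k j)) => [|k _].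
      by rewrite G0 mulr0.
    by rewrite GE.
  rewrite mxE -[RHS](linear0r B m) -w0 Bw; apply: eq_bigr => i _.
  by rewrite bE.
move=> /submxP[c /rowP bc].
exists (\sum_i c 0 i *: t`_i) => [|_ [d ->]]; first by exists (c 0).
rewrite linear_sumr big1 // => j _; rewrite linearZr linearBl linear_sumlz.
rewrite -bE bc mxE [X in _ - X](eq_bigr (fun i => c 0 i * G i j)) => [|i _].
  by rewrite subrr /= mulr0.
by rewrite GE linearZl.
Qed.

(** * Adjoint operators, primitive vectors and Serre relations for an HR-form *)

Section HRFormTheory.
Context (rR : realType) (V : vectType rR) (R : root_system V)
  (Pi : root_basis R) (K : fieldType) (M : graded_space R K).
Local Notation X := (weight R).
Local Notation S := (simple Pi).
Context (F : S -> {linear M -> M}) (B : {biscalar M}).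

Section Orthogonal.
Hypothesis B_orth : forall (mu nu : X) (u v : M),
  mu != nu -> piece mu u -> piece nu v -> B u v = 0.

(** Self-adjointness of the projections encodes the orthogonality of distinct weight spaces; it is
    checked on homogeneous vectors. *)
Lemma form_pr (mu : X) u v : B (pr mu u) v = B u (pr mu v).
Proof.
move: u; apply: piece_ind => [|nu u uP].
  by split=> [|c x y /= xE yE] /=; rewrite ?(linear0, linear0l) // linearP !linearPl xE yE.
move: v; apply: piece_ind => [|ka v vP] /=.
  by split=> [|c x y /= xE yE] /=; rewrite ?(linear0, linear0r) // !linearP /= xE yE.
rewrite (pr_piece_nat _ uP) (pr_piece_nat _ vP).
case: (eqVneq mu nu) => mn; case: (eqVneq mu ka) => mk //.
- by rewrite linear0r; apply: B_orth uP vP; rewrite -mn.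
- by rewrite linear0l; apply/esym/(B_orth _ uP vP); rewrite -mk eq_sym.
by rewrite linear0l linear0r.
Qed.

End Orthogonal.

Context (E : S -> {linear M -> M}).
Hypothesis Fd : forall a, homogeneous (- simple_weight a) (F a).
Hypothesis BHR : is_HR_form F B.
Hypothesis BEF : forall a u v, B (E a u) v = B u (F a v).
Hypothesis EF_H : forall a (mu : X) u, piece mu u ->
  E a (F a u) - F a (E a u) = (pairing R mu (val a))%:~R *: u.
Hypothesis EF_0 : forall a b u, a != b -> E a (F b u) - F b (E a u) = 0.

Let B_sym := HR_sym BHR.
Let B_pr := form_pr (HR_orth BHR).

Lemma form_eq0 u : (forall v, B u v = 0) -> u = 0.
Proof. by move=> u0; apply: (HR_nondeg BHR) => // v _; exact: u0. Qed.

(** The component of [E a u] in weight [nu] is tested against vectors [v] of weight [nu]; then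
    [F a v] is orthogonal to [u] unless [nu = mu + simple_weight a]. *)
Lemma adjoint_homogeneous a : homogeneous (simple_weight a) (E a).
Proof.
move=> mu u uP; suff -> : E a u = pr (mu + simple_weight a) (E a u) by exact: pr_piece.
apply: eq_pr => nu; rewrite pr_pr; case: eqVneq => [->//|nemu].
apply: form_eq0 => v; rewrite B_pr BEF (HR_orth BHR _ uP (Fd a (pr_piece nu v))) //.
by rewrite eq_sym subr_eq.
Qed.

Lemma HR_chevalley_ops : chevalley_ops E F.
Proof.
split=> [a||a mu m mP|a b m ab]; rewrite ?adE; first exact: adjoint_homogeneous.
- exact: Fd.
- exact: EF_H.
exact: EF_0.
Qed.

(** Chosen so that in weight [mu] the space [M_I] of this closed set [I] coincides with [imF]; the
    two inclusions are [M_closed_imF] and [imF_M_closed]. *)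
Let not_below (mu : X) : set X := [set nu | ~ weight_le Pi nu mu].

Lemma not_below_closed mu : closed_weights Pi (not_below mu).
Proof. by move=> nu ka nmu le_nk le_km; apply: nmu; exact: weight_le_trans le_km. Qed.

(** The generating weight spaces of [M_I] have weights different from [mu], so only images of the
    operators [F a] contribute in weight [mu]. *)
Lemma M_closed_imF mu m : M_closed F (not_below mu) m -> imF F (pr mu m).
Proof.
move: m; suff : M_closed F (not_below mu) `<=` pr mu @^-1` imF F by [].
apply: span_stable_ind => [|m [nu nmu mP]] /=.
  split=> [|a m _ _] /=; first exact/subspace_preim/imF_subspace.
  by rewrite (pr_lower Fd); exact: imF_F.
rewrite (pr_piece_nat _ mP); case: eqP => [munu|_]; last by case: (imF_subspace F).
by case: nmu; rewrite -munu; exact: weight_le_refl.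
Qed.

(** In weight [mu] the operator [F a] is applied to vectors of weight [mu + simple_weight a], which
    is not below [mu]. *)
Lemma imF_M_closed mu m : imF F m -> piece mu m -> M_closed F (not_below mu) m.
Proof.
move=> [g mE] mP; rewrite -(pr_id mP) mE linear_sum.
apply: subspace_sum => [|a _] /=; first exact: span_stable_subspace.
rewrite (pr_lower Fd); apply: (span_stable_stable setT F _).2 => //.
apply: span_stable_sub; exists (mu + simple_weight a); last exact: pr_piece.
exact: weight_le_addN.
Qed.

Lemma imF_piece_nondeg mu u : imF F u -> piece mu u ->
  (forall v, imF F v -> piece mu v -> B u v = 0) -> u = 0.
Proof.
move=> uF uP u0; apply: (HR_closed BHR (not_below_closed (mu := mu))).
  exact: imF_M_closed.
move=> v vI; rewrite -(pr_id uP) B_pr; apply: u0; first exact: M_closed_imF.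
exact: pr_piece.
Qed.

(** Adjointness makes primitive vectors orthogonal to [imF], and on [imF] the form is non-degenerate
    in each weight. *)
Lemma HR_prim_imF : prim E `&` imF F `<=` [set 0].
Proof.
move=> m [mp mF]; apply: pr_eq0 => mu.
apply: (@imF_piece_nondeg mu); first exact: (graded_imF HR_chevalley_ops).
  exact: pr_piece.
move=> _ [g ->] _; rewrite linear_sumr big1 // => a _.
by rewrite -BEF (graded_prim HR_chevalley_ops _ mp) linear0l.
Qed.

(** Within a weight space, subtract the orthogonal projection to [imF]. What remains is orthogonal
    to every [F a w], so its image under [E a] is orthogonal to everything. *)
Lemma HR_prim_split (s : seq M) : span_stable setT F [set` s] = setT ->
  forall m, exists p v, [/\ prim E p, imF F v & m = p + v].
Proof.
move=> Fs; apply: piece_ind => [|mu m mP] /=.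
  split=> [|c m m' [p [v [pp vF ->]]] [p' [v' [pp' vF' ->]]]].
    by exists 0, 0; split; rewrite ?addr0 //; [case: (prim_subspace E) | case: (imF_subspace F)].
  exists (c *: p + p'), (c *: v + v'); split; last by rewrite scalerDr addrACA.
    by case: (prim_subspace E) => _; apply.
  by case: (imF_subspace F) => _; apply.
have [t tP] := imF_piece_fg Fd Fs mu.
have [|v /tP[vF vP] mv0] := orthogonal_split (B := B) (t := t) _ m.
  move=> u /tP[uF uP] u0; apply: (imF_piece_nondeg uF uP) => v vF vP.
  by rewrite B_sym; apply: u0; apply/tP.
exists (m - v), v; split=> //; last by rewrite subrK.
move=> a; apply: form_eq0 => w; rewrite BEF.
have mvP : piece mu (m - v) by apply: subspaceB => //; exact: piece_subspace.
rewrite -(pr_id mvP) B_pr (pr_lower Fd); apply/mv0/tP.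
split; first exact: imF_F.
by rewrite -(pr_lower Fd); exact: pr_piece.
Qed.

(** Taking adjoints reverses products, so each commutator contributes a sign and the scalar is the
    [n]-th power of -1. *)
Lemma adjoint_serre a b n : exists c : K, forall u v,
  B (iter n (ad (E a)) (E b) u) v = c * B u (iter n (ad (F a)) (F b) v).
Proof.
elim: n => [|n [c IH]]; first by exists 1 => u v; rewrite mul1r BEF.
exists (- c) => u v; rewrite !iterS !adE linearBl linearBr /= BEF !IH BEF.
by rewrite -mulrBr mulNr -mulrN opprB.
Qed.

Lemma HR_serre (s : seq M) (a b : S) : span_stable setT F [set` s] = setT -> a != b ->
  (forall m, iter `|1 - cartan a b|%N (ad (F a)) (F b) m = 0) /\
  (forall m, iter `|1 - cartan a b|%N (ad (E a)) (E b) m = 0).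
Proof.
move=> Fs ab; have [h bM] := fg_bounded Fd Fs.
have F0 := serreF_eq0 HR_chevalley_ops ab bM HR_prim_imF.
split=> // m; apply: form_eq0 => v.
have [c ->] := adjoint_serre a b `|1 - cartan a b|%N.
by have := F0 v; rewrite /serreF => ->; rewrite linear0r mulr0.
Qed.

End HRFormTheory.

(** * Representations of the Lie algebra *)

Section LieEvaluation.
Context (K : fieldType) (I : finType) (A : I -> I -> int) (M : lmodType K)
  (E F : I -> {linear M -> M}).

(** With [WH a] interpreted as a commutator, the relation [cong_EF] holds by definition. *)
Fixpoint lie_eval (w : lie_word K I) : {linear M -> M} :=
  match w with
  | WE a => E a
  | WF a => F a
  | WH a => ad (E a) (F a)
  | WZero => \0
  | WOpp x => \- lie_eval x
  | WAdd x y => lie_eval x \+ lie_eval y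
  | WScale c x => c \*: lie_eval x
  | WBr x y => ad (lie_eval x) (lie_eval y)
  end.

Lemma lie_eval_iter n x y m :
  lie_eval (iter n (WBr x) y) m = iter n (ad (lie_eval x)) (lie_eval y) m.
Proof. by elim: n m => // n IH m; rewrite !iterS /= !IH. Qed.

Hypothesis HH : forall a b m, ad (ad (E a) (F a)) (ad (E b) (F b)) m = 0.
Hypothesis HE : forall a b m, ad (ad (E a) (F a)) (E b) m = (A a b)%:~R *: E b m.
Hypothesis HF : forall a b m, ad (ad (E a) (F a)) (F b) m = - (A a b)%:~R *: F b m.
Hypothesis EF0 : forall a b m, a != b -> ad (E a) (F b) m = 0.
Hypothesis serreE : forall a b m, a != b -> iter `|1 - A a b|%N (ad (E a)) (E b) m = 0.
Hypothesis serreF : forall a b m, a != b -> iter `|1 - A a b|%N (ad (F a)) (F b) m = 0.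

Lemma lie_eval_cong x y : lie_cong A x y -> lie_eval x =1 lie_eval y.
Proof.
elim=> {x y} /=.
- by [].
- by move=> x y _ IH m; rewrite IH.
- by move=> x y z _ IH1 _ IH2 m; rewrite IH1 IH2.
- by move=> x x' _ IH m /=; rewrite IH.
- by move=> x x' y y' _ IH1 _ IH2 m /=; rewrite IH1 IH2.
- by move=> c x x' _ IH m /=; rewrite IH.
- by move=> x x' y y' _ IH1 _ IH2 m /=; rewrite !IH1 !IH2.
- by move=> x y z m /=; rewrite addrA.
- by move=> x y m /=; rewrite addrC.
- by move=> x m /=; rewrite add0r.
- by move=> x m /=; rewrite addNr.
- by move=> c d x m /=; rewrite scalerA.
- by move=> x m /=; rewrite scale1r.
- by move=> c x y m /=; rewrite scalerDr.
- by move=> c d x m /=; rewrite scalerDl.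
- by move=> x y z m /=; rewrite linearD opprD addrACA.
- by move=> x y z m /=; rewrite linearD opprD addrACA.
- by move=> c x y m /=; rewrite linearZ scalerBr.
- by move=> c x y m /=; rewrite linearZ scalerBr.
- by move=> x m /=; rewrite subrr.
- by move=> x y z m; exact: ad_jacobi_cyc.
- by move=> a b m; exact: HH.
- by move=> a b m; exact: HE.
- by move=> a b m; exact: HF.
- by [].
- by move=> a b ab m; exact: EF0.
- by move=> a b ab m; rewrite lie_eval_iter serreE.
- by move=> a b ab m; rewrite lie_eval_iter serreF.
Qed.

Lemma lie_eval_bilinear : exists rho : {bilinear lie_alg K A -> M -> M},
  forall w m, rho (lie_pi A w) m = lie_eval w m.
Proof.
(* A class acts through its chosen representative; [fE] says that any other representative acts in
   the same way. *)
pose f (x : lie_alg K A) (m : M) : M := lie_eval (repr x) m.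
have fE w m : f (lie_pi A w) m = lie_eval w m by exact/lie_eval_cong/lie_repr.
have f_lin : bilinear_for *:%R *:%R f.
  split=> [m c|x]; last exact: linearP.
  elim/lie_piW=> x; elim/lie_piW=> y.
  have -> : c *: lie_pi A x + lie_pi A y = lie_pi A (WAdd (WScale c x) y).
    by rewrite /GRing.scale /= lie_scaleE /GRing.add /= lie_addE.
  by rewrite !fE.
pose rho : {bilinear lie_alg K A -> M -> M} :=
  HB.pack f (bilinear_isBilinear.Build K _ _ _ _ _ f f_lin).
by exists rho.
Qed.

End LieEvaluation.

Section LieAlgebra.
Context (rR : realType) (V : vectType rR) (R : root_system V)
  (Pi : root_basis R) (K : fieldType).
Local Notation X := (weight R).
Local Notation S := (simple Pi).
Local Notation g := (g_alg Pi K).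

Lemma g_br_ef a : g_br (g_e K a) (g_f K a) = g_h K a :> g.
Proof. by rewrite /g_br /g_e /g_f /lie_e /lie_f lie_brE; exact/lie_piP/cong_EF. Qed.

Lemma g_br_ef0 (a b : S) : a != b -> g_br (g_e K a) (g_f K b) = 0 :> g.
Proof. by move=> ab; rewrite /g_br /g_e /g_f /lie_e /lie_f lie_brE; exact/lie_piP/cong_EF0. Qed.

(** Each [g_h K a] is the bracket of [g_e K a] and [g_f K a], so these two families generate the Lie
    algebra. *)
Lemma g_ind (P : set g) : lie_subalgebra P -> (forall a, P (g_e K a)) ->
  (forall a, P (g_f K a)) -> forall x, P x.
Proof.
move=> [sP Pbr] PE PF.
have lieE (w : lie_word K S) : P (lie_pi _ w).
  elim: w => [a|a|a||w IH|w IH w' IH'|c w IH|w IH w' IH'].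
  - exact: PE.
  - exact: PF.
  - by rewrite -[lie_pi _ _]/(g_h K a) -g_br_ef; exact: Pbr.
  - by case: sP.
  - by rewrite -lie_oppE; exact: (subspaceN sP IH).
  - by rewrite -lie_addE; exact: (subspaceD sP IH IH').
  - by rewrite -lie_scaleE; exact: (subspaceZ _ sP IH).
  - by rewrite -lie_brE; exact: Pbr.
by elim/lie_piW=> w.
Qed.

Lemma g_f_bminus a : (@g_bminus _ _ R Pi K) (g_f K a).
Proof.
exists (g_f K a), 0; split; last by rewrite addr0.
  by move=> A [_]; apply; exists a.
by move=> A [[A0 _] _].
Qed.

Section Rep.
Context (M : graded_space R K) (rho : {bilinear g -> M -> M}).
Hypothesis rho_rep : is_graded_rep rho.

Definition repE (a : S) : {linear M -> M} := rho (g_e K a).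
Definition repF (a : S) : {linear M -> M} := rho (g_f K a).

Lemma rep_chevalley_ops : chevalley_ops repE repF.
Proof.
split=> [a|a|a mu m mP|a b m ab].
- exact: (rep_e rho_rep a).
- exact: (rep_f rho_rep a).
- by rewrite adE -(rep_h rho_rep a mP) -g_br_ef (rep_br rho_rep).
by rewrite adE -(rep_br rho_rep) g_br_ef0 // linear0l.
Qed.

(** The elements whose action preserves [A] form a Lie subalgebra, so [g_ind] applies. *)
Lemma rep_stable (A : set M) : subspace A -> (forall a m, A m -> A (repE a m)) ->
  (forall a m, A m -> A (repF a m)) -> stable_subspace setT rho A.
Proof.
move=> sA AE AF; split=> // x m _; move: m.
apply: (@g_ind [set x | forall m, A m -> A (rho x m)]) => [|a m|a m] /=.
- split=> [|x1 x2 A1 A2 m Am] /=.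
    split=> [m _|c x1 x2 A1 A2 m Am] /=; first by rewrite linear0l; case: sA.
    by rewrite linearPl; apply: sA.2; [exact: A1 | exact: A2].
  by rewrite (rep_br rho_rep); apply: subspaceB => //; auto.
- exact: AE.
- exact: AF.
Qed.

(** Let [A] be a subrepresentation without [v]. By upward induction a homogeneous [m] in [A] is
    primitive. It is congruent to a multiple of [v] modulo [imF], hence equal to it because [prim]
    and [imF] meet in 0; so [m = 0]. *)
Lemma rep_irreducible (v : M) (h : rR) : v != 0 -> prim repE v ->
  span_stable setT repF [set v] = setT -> bounded_above Pi M h ->
  prim repE `&` imF repF `<=` [set 0] -> irreducible_rep (GradedRep rho_rep).
Proof.
move=> v0 pv Fv bM pi0; split=> [|A [/graded_subspace_pr[sA grA] [_ stA]]]; first by exists v.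
have [Av|nAv] := pselect (A v).
  right; apply/seteqP; split=> // m _.
  have : span_stable setT repF [set v] m by rewrite Fv.
  by move: m; apply: span_stable_ind => [|_ -> //]; split=> // a m _; apply: stA.
left; apply/seteqP; split=> [m Am|_ ->]; last by case: sA.
suff A0 : forall (mu : X) m, A m -> piece mu m -> m = 0.
  by apply: pr_eq0 => mu; apply: (A0 mu); [exact: grA | exact: pr_piece].
elim/(@weight_ind_up _ _ _ Pi h) => {Am m} [mu hmu|mu IH] m Am mP; first exact: bM hmu.
have pm : prim repE m.
  by move=> a; apply: (IH a); [exact: stA | exact: (rep_e rho_rep)].
have [|u [f [[c uE] fF mE]]] := @comb_imF _ _ _ _ _ M repF [:: v] _ m.
  by rewrite -Fv; congr span_stable; apply/seteqP; split=> x /=; rewrite inE => /eqP.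
move: uE; rewrite /= big_ord1 /= => uE.
have f0 : f = 0.
  apply: (pi0 f); split=> //; have -> : f = m - c ord0 *: v by rewrite mE uE addrC addKr.
  exact: (subspaceB (prim_subspace _) pm (subspaceZ _ (prim_subspace _) pv)).
move: mE; rewrite uE f0 addr0 => mE.
have [c0|c0] := eqVneq (c ord0) 0; first by rewrite mE c0 scale0r.
case: nAv; rewrite -[v](scalerK c0) -mE; exact: subspaceZ.
Qed.

End Rep.

End LieAlgebra.

(** * Stable graded subspaces as graded representations of their own *)

Section Submodule.
Context (K : fieldType) (M : lmodType K).

Record submod := Submod { submod_set :> set M; submod_ok : subspace submod_set }.
Implicit Type S : submod.

Definition submod_pred S : {pred M} := [pred m | `[< submod_set S m >]].

Fact submod_pred_closed S : submod_closed (submod_pred S).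
Proof.
have [S0 Slin] := submod_ok S.
split=> [|c u v]; first exact/asboolP.
by move=> /asboolP Su /asboolP Sv; apply/asboolP/Slin.
Qed.
HB.instance Definition _ S :=
  GRing.isSubmodClosed.Build K M (submod_pred S) (submod_pred_closed S).

Record submod_type S := SubmodElt { submod_val : M; _ : submod_val \in submod_pred S }.

HB.instance Definition _ S := [isSub for @submod_val S].
HB.instance Definition _ S := [Choice of submod_type S by <:].
HB.instance Definition _ S := [SubChoice_isSubLmodule of submod_type S by <:].

Definition submod_in S m (Sm : submod_set S m) : submod_type S := SubmodElt (asboolT Sm).

Lemma submod_valP S (u : submod_type S) : submod_set S (submod_val u).
Proof. by case: u => u /= /asboolP. Qed.

Lemma submod_val_inj S : injective (@submod_val S).
Proof. exact: val_inj. Qed.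

Lemma submod_val_linear S : linear (@submod_val S).
Proof. by []. Qed.
HB.instance Definition _ S :=
  GRing.isLinear.Build K (submod_type S) M _ (@submod_val S) (@submod_val_linear S).

End Submodule.

Section Subrepresentation.
Context (rR : realType) (V : vectType rR) (R : root_system V)
  (Pi : root_basis R) (K : fieldType).
Local Notation X := (weight R).
Local Notation S := (simple Pi).
Local Notation g := (g_alg Pi K).
Context (M : graded_space R K) (rho : {bilinear g -> M -> M}).
Hypothesis rho_rep : is_graded_rep rho.
Context (A : set M) (v : M).
Hypothesis sA : subspace A.
Hypothesis grA : graded_set A.
Hypothesis stA : stable_subspace setT rho A.
Hypothesis Av : A v.
Hypothesis A_gen : A `<=` span_stable setT (repF rho) [set v].

Local Notation N := (submod_type (Submod sA)).
Local Notation sub_in := (@submod_in _ _ (Submod sA) _).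

Definition sub_piece (mu : X) : set N := [set u | piece mu (submod_val u)].

Fact sub_piece_subspace mu : subspace (sub_piece mu).
Proof. exact: (subspace_preim (@submod_val _ _ (Submod sA)) (piece_subspace M mu)). Qed.

Fact sub_piece_sum (u : N) : exists (s : seq X) (c : X -> N),
  (forall mu, sub_piece mu (c mu)) /\ u = \sum_(mu <- s) c mu.
Proof.
have [s [_ _ uE]] := pr_sum (submod_val u).
exists s, (fun mu => sub_in (grA mu (submod_valP u)) : N); split=> [mu|].
  exact: pr_piece.
by apply: submod_val_inj; rewrite linear_sum /=.
Qed.

Fact sub_piece_direct (s : seq X) (c : X -> N) : uniq s ->
  (forall mu, sub_piece mu (c mu)) -> \sum_(mu <- s) c mu = 0 ->
  forall mu, mu \in s -> c mu = 0.
Proof.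
move=> us cP c0 mu mus; apply: submod_val_inj.
apply: (piece_direct us cP _ mus).
by rewrite -(linear_sum (@submod_val _ _ _)) c0.
Qed.

Definition sub_graded : graded_space R K :=
  GradedSpace sub_piece_subspace sub_piece_sum sub_piece_direct.

Definition sub_act (x : g) (u : sub_graded) : sub_graded :=
  sub_in (stA.2 x _ I (submod_valP u)).

Fact sub_act_bilinear : bilinear_for *:%R *:%R sub_act.
Proof.
split=> [u c x y|x c u w]; apply: submod_val_inj => /=.
  by rewrite linearPl.
by rewrite linearPr.
Qed.

Definition sub_rho : {bilinear g -> sub_graded -> sub_graded} :=
  HB.pack sub_act (bilinear_isBilinear.Build K _ _ _ _ _ sub_act sub_act_bilinear).

Lemma sub_gen : span_stable setT (repF sub_rho) [set sub_in Av : sub_graded] = setT.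
Proof.
apply/seteqP; split=> // u _.
suff : A `<=` [set m | forall Am : A m,
    span_stable setT (repF sub_rho) [set sub_in Av : sub_graded] (sub_in Am : sub_graded)].
  move=> /(_ _ (submod_valP u) (submod_valP u)); congr span_stable.
  exact: submod_val_inj.
move=> m /A_gen; move: m.
have A_F a m : A m -> A (repF rho a m) by exact: stA.2.
(* An element of the submodule carries a proof of membership in [A]; the induction therefore
   establishes membership along the way and treats all such proofs at once. *)
suff : span_stable setT (repF rho) [set v] `<=` [set m | A m /\ forall Am : A m,
    span_stable setT (repF sub_rho) [set sub_in Av : sub_graded] (sub_in Am : sub_graded)].
  by move=> AB m /AB[].
apply: span_stable_ind => [|_ ->]; last first.
  split=> // Av'; apply: span_stable_sub; exact: submod_val_inj.
have [B0 Blin] := span_stable_subspace setT (repF sub_rho) [set sub_in Av : sub_graded].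
split=> [|a m _ [Am Bm]]; last first.
  split=> [|AFm]; first exact: A_F.
  have -> : sub_in AFm = repF sub_rho a (sub_in Am : sub_graded).
    exact: submod_val_inj.
  by apply: (span_stable_stable setT (repF sub_rho) _).2.
split=> [|c m1 m2 [A1 B1] [A2 B2]].
  split=> [|A0]; first by case: sA.
  have -> : sub_in A0 = 0 by exact: submod_val_inj.
  exact: B0.
split=> [|A12]; first exact: sA.2.
have -> : sub_in A12 = c *: sub_in A1 + sub_in A2 by exact: submod_val_inj.
exact: Blin.
Qed.

Lemma sub_rep : is_graded_rep sub_rho.
Proof.
split=> [x y u|a mu u uP|a mu u uP|a mu u uP|].
- by apply: submod_val_inj; exact: (rep_br rho_rep).
- exact: (rep_e rho_rep a uP).
- exact: (rep_f rho_rep a uP).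
- by apply: submod_val_inj; exact: (rep_h rho_rep a uP).
exists [set sub_in Av : sub_graded]; split; first exact: finite_set1.
apply/seteqP; split=> // u _; have : [set: sub_graded] u by [].
rewrite -sub_gen; move: u; apply: span_stable_ind; last exact: span_stable_sub.
have [sB stB] := span_stable_stable (@g_bminus _ _ R Pi K) sub_rho [set sub_in Av : sub_graded].
by split=> // a u _; apply: stB; exact: g_f_bminus.
Qed.

Lemma sub_is_L lambda h : piece lambda v -> v != 0 -> prim (repE rho) v ->
  bounded_above Pi M h -> prim (repE rho) `&` imF (repF rho) `<=` [set 0] ->
  is_L lambda (GradedRep sub_rep).
Proof.
move=> vP v0 pv bM pi0.
have v0' : (sub_in Av : sub_graded) != 0.
  by apply: contra_neq v0 => /(congr1 (@submod_val _ _ _)).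
have pv' : prim (repE sub_rho) (sub_in Av : sub_graded).
  by move=> a; apply: submod_val_inj; exact: pv.
split.
  apply: (rep_irreducible _ v0' pv' sub_gen (h := h)) => [mu u uP hmu|u [pu [f uE]]].
    by apply: submod_val_inj; exact: bM uP hmu.
  apply: submod_val_inj; apply: (pi0 (submod_val u)); split=> [a|].
    by have := congr1 (@submod_val _ _ _) (pu a).
  exists (fun a => submod_val (f a)).
  by rewrite uE linear_sum.
exists (sub_in Av : sub_graded); split; [exact: v0' | exact: vP | exact: pv' |].
apply/seteqP; split=> // u _; have : [set: sub_graded] u by [].
rewrite -sub_gen; move: u; apply: span_stable_ind; last exact: span_stable_sub.
have [sB stB] := span_stable_stable setT sub_rho [set sub_in Av : sub_graded].
by split=> // a u _; apply: stB.
Qed.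

End Subrepresentation.

(** * Complete reducibility *)

Section PrimitiveGenerators.
Context (rR : realType) (V : vectType rR) (R : root_system V)
  (Pi : root_basis R) (K : fieldType) (M : graded_space R K).
Local Notation X := (weight R).
Local Notation S := (simple Pi).
Context (E F : S -> {linear M -> M}) (s : seq M).
Hypothesis EF : chevalley_ops E F.
Hypothesis Fs : span_stable setT F [set` s] = setT.
Hypothesis prim_split : forall m, exists p v, [/\ prim E p, imF F v & m = p + v].

Let modF (L : seq M) : set M := [set m | exists2 u, comb L u & imF F (m - u)].

Lemma modF_subspace L : subspace (modF L).
Proof.
split=> [|c m m' [u Lu Fu] [u' Lu' Fu']].
  by exists 0; rewrite ?subrr; [case: (comb_subspace L) | case: (imF_subspace F)].
exists (c *: u + u'); first exact: (comb_subspace L).2.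
have -> : c *: m + m' - (c *: u + u') = c *: (m - u) + (m' - u').
  by rewrite opprD addrACA scalerBr.
exact: (imF_subspace F).2.
Qed.

Lemma modF_mono L L' : {subset L <= L'} -> modF L `<=` modF L'.
Proof. by move=> LL m [u Lu Fu]; exists u => //; exact: comb_mono Lu. Qed.

(** Modulo [imF] a vector equals its primitive part, and the weight components of a primitive vector
    are again primitive. *)
Lemma homogeneous_prim_gens (t : seq M) : exists L : seq M,
  (forall y, y \in L -> prim E y /\ exists mu : X, piece mu y) /\
  forall m, m \in t -> modF L m.
Proof.
elim: t => [|m t [L [LP Lt]]]; first by exists [::].
have [p [v [pp vF mE]]] := prim_split m; have [q [_ _ pE]] := pr_sum p.
exists (map (fun mu => pr mu p) q ++ L); split=> [y|y].
  rewrite mem_cat => /orP[/mapP[mu _ ->]|/LP //].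
  by split; [exact: (graded_prim EF) | exists mu; exact: pr_piece].
rewrite inE => /orP[/eqP ->|/Lt]; last first.
  by apply: modF_mono => z zL; rewrite mem_cat zL orbT.
exists p; last by rewrite mE addrC addKr.
rewrite [X in comb _ X]pE big_seq; apply: subspace_sum => [|mu muq]; first exact: comb_subspace.
by apply: mem_comb; rewrite mem_cat; apply/orP; left; apply: (map_f (fun mu => pr mu p)).
Qed.

Definition generating n (x : 'I_n -> M) :=
  forall m, exists c : 'I_n -> K, imF F (m - \sum_i c i *: x i).

Definition independent n (x : 'I_n -> M) :=
  forall c : 'I_n -> K, imF F (\sum_i c i *: x i) -> forall i, c i = 0.

Definition primitive_family n (x : 'I_n -> M) (lambda : 'I_n -> X) :=
  forall i, prim E (x i) /\ piece (lambda i) (x i).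

Lemma independent_subfamily n (x : 'I_n -> M) lambda :
  primitive_family x lambda -> generating x ->
  exists n' (x' : 'I_n' -> M) lambda',
    [/\ primitive_family x' lambda', generating x' & independent x'].
Proof.
elim: n x lambda => [|n IH] x lambda xP xG.
  by exists 0, x, lambda; split=> // c _ [].
have [xI|/existsNP[d /not_implyP[dF /existsNP[j /eqP dj]]]] := pselect (independent x).
  by exists n.+1, x, lambda.
apply: (IH (x \o lift j) (lambda \o lift j)) => [i|m]; first exact: xP.
have [c mF] := xG m.
(* The relation [d] is used to eliminate [x j]: the coefficient [c' j] is 0. *)
pose c' i := c i - c j / d j * d i.
exists (c' \o lift j).
have -> : m - \sum_i (c' \o lift j) i *: (x \o lift j) i =
    m - \sum_i c i *: x i + (c j / d j) *: \sum_i d i *: x i.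
  have <- : \sum_i c' i *: x i = \sum_i (c' \o lift j) i *: (x \o lift j) i.
    rewrite [LHS](bigD1_ord j) //= {1}/c' divfK // subrr scale0r add0r.
    by [].
  rewrite -addrA; congr (_ + _); rewrite scaler_sumr -[RHS]opprK opprD opprK; congr (- _).
  rewrite -sumrB; apply: eq_bigr => i _.
  by rewrite scalerA -scalerBl.
by apply: subspaceD; [exact: imF_subspace | | apply: subspaceZ => //; exact: imF_subspace].
Qed.

Lemma primitive_generators : exists n (x : 'I_n -> M) lambda,
  [/\ primitive_family x lambda, generating x & independent x].
Proof.
have [L [LP Ls]] := homogeneous_prim_gens s.
have [lambda lambdaP] : {lambda : 'I_(size L) -> X &
    forall i : 'I_(size L), prim E L`_i /\ piece (lambda i) L`_i}.
  apply: (@choice _ _ (fun (i : 'I_(size L)) mu => prim E L`_i /\ piece mu L`_i)) => i.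
  by have [|? [mu ?]] := LP L`_i; [exact: mem_nth | exists mu].
apply: (independent_subfamily lambdaP) => m.
have [u [v [us vF ->]]] := comb_imF Fs m.
have [_ [c ->] uF] := comb_sub (modF_subspace L) Ls us.
exists c; rewrite -addrAC; apply: subspaceD => //; exact: imF_subspace.
Qed.

End PrimitiveGenerators.

(** * The submodule generated by a homogeneous primitive vector *)

Section HighestWeightSpan.
Context (rR : realType) (V : vectType rR) (R : root_system V)
  (Pi : root_basis R) (K : fieldType).
Local Notation X := (weight R).
Local Notation S := (simple Pi).
Local Notation g := (g_alg Pi K).
Context (M : graded_space R K) (rho : {bilinear g -> M -> M}).
Hypothesis rho_rep : is_graded_rep rho.
Context (v : M) (lambda : X).
Hypothesis vP : piece lambda v.
Local Notation E := (repE rho).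
Local Notation F := (repF rho).
Hypothesis vprim : prim E v.
Let EF := rep_chevalley_ops rho_rep.

Definition hw_span : set M := span_stable setT F [set v].

Lemma hw_span_subspace : subspace hw_span.
Proof. exact: span_stable_subspace. Qed.

Lemma hw_span_F a m : hw_span m -> hw_span (F a m).
Proof. exact: (span_stable_stable setT F _).2. Qed.

Lemma hw_span_gen : hw_span v.
Proof. exact: span_stable_sub. Qed.

Lemma hw_span_graded : graded_set hw_span.
Proof.
move=> mu m im; move: m im mu.
suff : hw_span `<=` [set m | forall mu, hw_span (pr mu m)] by [].
have [l0 lL] := hw_span_subspace.
apply: span_stable_ind => [|_ -> mu].
  split=> [|a m _ im mu]; last by rewrite (pr_F EF); exact: hw_span_F.
  split=> [mu|c u w iu iw mu]; first by rewrite linear0.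
  by rewrite linearP; exact: lL (iu mu) (iw mu).
by rewrite (pr_piece_nat _ vP); case: eqP => // _; exact: hw_span_gen.
Qed.

(** Moving [E a] past [F b] leaves at most a term with [opH a]. This acts by scalars on weight
    components, which stay inside because the span is graded. *)
Lemma hw_span_stable : stable_subspace setT rho hw_span.
Proof.
apply: (rep_stable rho_rep hw_span_subspace); last exact: hw_span_F.
move=> a m im; move: m im a.
suff : hw_span `<=` [set m | hw_span m /\ forall a, hw_span (E a m)] by move=> + m im => /(_ m im)[].
have [l0 lL] := hw_span_subspace.
apply: span_stable_ind => [|_ ->]; last first.
  by split=> [|a]; [exact: hw_span_gen | rewrite vprim].
split=> [|b m _ [im iE]]; last first.
  split=> [|a]; first exact: hw_span_F.
  rewrite (EF_comm EF); apply: (subspaceD hw_span_subspace); first exact: hw_span_F.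
  case: ifP => // _; apply: subspace_pr => [|mu]; first exact: hw_span_subspace.
  rewrite (pr_opH EF); apply: (subspaceZ _ hw_span_subspace); exact: hw_span_graded.
split=> [|c u w [iu uE] [iw wE]]; first by split=> // a; rewrite linear0.
by split=> [|a]; [exact: lL | rewrite linearP; exact: lL (uE a) (wE a)].
Qed.

Lemma hw_span_imF m : hw_span m -> exists c, imF F (m - c *: v).
Proof.
move: m; apply: span_stable_ind => [|_ ->]; last first.
  by exists 1; rewrite scale1r subrr; case: (imF_subspace F).
split=> [|a m _ _]; last by exists 0; rewrite scale0r subr0; exact: imF_F.
split=> [|k u w [c uF] [d wF]].
  by exists 0; rewrite scale0r subr0; case: (imF_subspace F).
exists (k * c + d).
have -> : k *: u + w - (k * c + d) *: v = k *: (u - c *: v) + (w - d *: v).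
  by rewrite scalerDl opprD addrACA scalerBr scalerA.
exact: (imF_subspace F).2.
Qed.

End HighestWeightSpan.

(** * The direct sum of the submodules generated by a primitive basis modulo [imF] *)

Section Decomposition.
Context (rR : realType) (V : vectType rR) (R : root_system V)
  (Pi : root_basis R) (K : fieldType).
Local Notation X := (weight R).
Local Notation S := (simple Pi).
Local Notation g := (g_alg Pi K).
Context (M : graded_space R K) (rho : {bilinear g -> M -> M}).
Hypothesis rho_rep : is_graded_rep rho.
Context (h : rR) (n : nat) (x : 'I_n -> M) (lambda : 'I_n -> X).
Hypothesis bM : bounded_above Pi M h.
Hypothesis pi0 : prim (repE rho) `&` imF (repF rho) `<=` [set 0].
Hypothesis xP : primitive_family (repE rho) x lambda.
Hypothesis xG : generating (repF rho) x.
Hypothesis xI : independent (repF rho) x.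

Local Notation E := (repE rho).
Local Notation F := (repF rho).
Let EF := rep_chevalley_ops rho_rep.

Local Notation lower i := (hw_span rho (x i)).
Let lower_subspace i : subspace (lower i) := @hw_span_subspace _ _ _ _ _ _ rho (x i).
Let lower_F i a m : lower i m -> lower i (F a m) := @hw_span_F _ _ _ _ _ _ rho (x i) a m.
Let lower_gen i : lower i (x i) := @hw_span_gen _ _ _ _ _ _ rho (x i).
Let lower_graded i : graded_set (lower i) := hw_span_graded rho_rep (xP i).2.
Let lower_stable i : stable_subspace setT rho (lower i) :=
  hw_span_stable rho_rep (xP i).2 (xP i).1.

(** In a homogeneous relation the vectors [E a (u j)] satisfy a relation of higher weight and vanish
    by induction. So each [u j] is primitive and, as [prim] and [imF] meet in 0, a multiple of
    [x j]; independence of the [x j] concludes. *)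
Lemma hw_span_sum_direct (u : 'I_n -> M) :
  (forall i, lower i (u i)) -> \sum_i u i = 0 -> forall i, u i = 0.
Proof.
move=> uL u0; suff uhom : forall mu (u : 'I_n -> M), (forall i, lower i (u i)) ->
    (forall i, piece mu (u i)) -> \sum_i u i = 0 -> forall i, u i = 0.
  move=> i; apply: pr_eq0 => mu.
  apply: (uhom mu (fun i => pr mu (u i))) => [j|j|]; first exact: lower_graded.
    exact: pr_piece.
  by rewrite -linear_sum u0 linear0.
move=> {uL u0 u}; elim/(@weight_ind_up _ _ _ Pi h) => [mu hmu|mu IH] u uL uP u0 i.
  exact: bM (uP i) hmu.
have pu j : prim E (u j).
  move=> a; apply: (IH a (fun j => E a (u j))) => [k|k|].
  - exact: (lower_stable k).2.
  - exact: (chev_E EF).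
  by rewrite -linear_sum u0 linear0.
have uE j : exists c, u j = c *: x j.
  have [c uF] := hw_span_imF (uL j); exists c; apply: subr0_eq.
  apply: (@pi0 (u j - c *: x j)); split=> //.
  apply: (subspaceB (prim_subspace E) (pu j)).
  exact: (subspaceZ _ (prim_subspace E) (xP j).1).
have [c cE] := choice uE.
suff c0 : c i = 0 by rewrite cE c0 scale0r.
apply: xI; rewrite -(eq_bigr _ (fun j _ => cE j)) u0.
by case: (imF_subspace F).
Qed.

(** Upward induction: modulo [imF] a vector is a combination of the [x i], and the remainder
    consists of images under [F a] of vectors of higher weight. *)
Lemma hw_span_sum_surj m : exists2 u : 'I_n -> M, (forall i, lower i (u i)) & m = \sum_i u i.
Proof.
pose Q : set M := [set m | exists2 u : 'I_n -> M, (forall i, lower i (u i)) & m = \sum_i u i].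
have sQ : subspace Q.
  split=> [|c _ _ [u uL ->] [w wL ->]].
    by exists (fun=> 0) => [i|]; [case: (lower_subspace i) | rewrite big1].
  exists (fun i => c *: u i + w i) => [i|]; first exact: (lower_subspace i).2.
  by rewrite big_split scaler_sumr.
have Qx i : Q (x i).
  exists (fun j => if j == i then x i else 0) => [j|].
    by case: eqP => [->|_]; [exact: lower_gen | case: (lower_subspace j)].
  by rewrite (bigD1 i) //= eqxx big1 ?addr0 // => j /negPf ->.
have QF a m' : Q m' -> Q (F a m').
  move=> [u uL ->]; exists (fun i => F a (u i)) => [i|]; first exact: lower_F.
  exact: linear_sum.
suff Qp : forall mu m, piece mu m -> Q m by apply: (piece_ind sQ Qp).
elim/(@weight_ind_up _ _ _ Pi h) => [mu hmu|mu IH] {}m mP.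
  by rewrite (bM mP hmu); case: sQ.
have [c [f mE]] := xG m.
have -> : m = \sum_i c i *: pr mu (x i) + \sum_a F a (pr (mu + simple_weight a) (f a)).
  rewrite -[LHS](pr_id mP) -[m in LHS](subrK (\sum_i c i *: x i)) mE addrC.
  rewrite linearD !linear_sum; congr (_ + _); apply: eq_bigr => i _ /=.
    by rewrite linearZ.
  exact: (pr_F EF).
apply: (@subspaceD _ _ Q) => //; apply: (@subspace_sum _ _ Q) => // i _.
  apply: (@subspaceZ _ _ Q) => //; rewrite (pr_piece_nat _ (xP i).2).
  by case: ifP => // _; case: sQ.
by apply: QF; apply: (IH i); exact: pr_piece.
Qed.

Lemma decomposition_semisimple : semisimple_rep (GradedRep rho_rep).
Proof.
have gen i : lower i `<=` span_stable setT F [set x i] by [].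
pose N i := GradedRep (sub_rep rho_rep (lower_subspace i) (@lower_graded i) (lower_stable i)
  (@lower_gen i) (@gen i)).
exists n, N, lambda; split=> [i|].
  apply: (sub_is_L _ _ _ _ _ _ (xP i).2 _ (xP i).1 bM pi0).
  (* No [x i] vanishes: otherwise the coefficients that single out [i] would contradict
     independence. *)
  apply/eqP => x0; suff : (i == i)%:R = 0 :> K by rewrite eqxx => /eqP; rewrite oner_eq0.
  apply: (xI (c := fun j => (j == i)%:R)); rewrite (bigD1 i) //= eqxx x0 scaler0 add0r.
  rewrite big1 => [|j /negPf ->]; last by rewrite scale0r.
  by case: (imF_subspace F).
exists (fun u : forall i, N i => \sum_i submod_val (u i)); split.
- by move=> c u v; rewrite scaler_sumr -big_split.
- have phi_inj (u v : forall i, N i) :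
      \sum_i submod_val (u i) = \sum_i submod_val (v i) -> u = v.
    move=> uv; apply: functional_extensionality_dep => i; apply: submod_val_inj.
    apply: subr0_eq.
    apply: (@hw_span_sum_direct (fun i => submod_val (u i) - submod_val (v i))) => [j|].
      have uL (w : submod_type (Submod (lower_subspace j))) : lower j (submod_val w).
        exact: (submod_valP w).
      exact: (subspaceB (lower_subspace j) (uL (u j)) (uL (v j))).
    by rewrite sumrB uv subrr.
  have phi_surj m : exists u : forall i, N i, \sum_i submod_val (u i) = m.
    have [u uL ->] := hw_span_sum_surj m.
    by exists (fun i => @submod_in _ _ (Submod (lower_subspace i)) _ (uL i)).
  have [psi psiK] := choice phi_surj.
  by exists psi => [u|m]; [apply: phi_inj; rewrite psiK | exact: psiK].
- move=> mu u uP; apply: subspace_sum => [|i _]; first exact: piece_subspace.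
  exact: uP.
- by move=> y u; rewrite linear_sumr.
Qed.

End Decomposition.

(** * Contravariant forms *)

Section ContravariantForm.
Context (rR : realType) (V : vectType rR) (R : root_system V)
  (Pi : root_basis R) (K : fieldType) (N : graded_space R K).
Local Notation X := (weight R).
Local Notation S := (simple Pi).
Context (E F : S -> {linear N -> N}) (v : N) (lambda : X).
Hypothesis EF : chevalley_ops E F.
Hypothesis vP : piece lambda v.
Hypothesis v0 : v != 0.
Hypothesis vprim : prim E v.
Hypothesis Fv : span_stable setT F [set v] = setT.

Lemma gen_ind (A : set N) : subspace A -> A v -> (forall a m, A m -> A (F a m)) ->
  forall m, A m.
Proof.
move=> sA Av AF m; have : [set: N] m by [].
rewrite -Fv; move: m; apply: span_stable_ind => [|_ -> //].
by split=> // a m _; exact: AF.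
Qed.

Lemma hw_weight_le (mu : X) (m : N) : piece mu m -> m != 0 -> weight_le Pi mu lambda.
Proof.
move=> mP; have [//|nle] := pselect (weight_le Pi mu lambda).
rewrite -(pr_id mP) => /eqP[]; move: mu nle {mP}; move: m; apply: gen_ind => [|mu nle|a m m0 mu nle].
- split=> [mu _|c u w u0 w0 mu nle]; first by rewrite linear0.
  by rewrite linearP /= u0 // w0 // scaler0 addr0.
- rewrite (pr_piece_nat _ vP); case: eqP => // mul; case: nle; rewrite mul.
  exact: weight_le_refl.
rewrite (pr_F EF) m0 ?linear0 // => le_ml; apply: nle; apply: weight_le_trans le_ml.
by have := weight_le_sub (mu + simple_weight a) a; rewrite addrK.
Qed.

(** A nonzero value would come from a vector of weight [lambda + simple_weight a], but all weights
    are at most [lambda]. *)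
Lemma pr_hw_F a m : pr lambda (F a m) = 0.
Proof.
rewrite (pr_F EF); apply/eqP; apply/negPn/negP => ne0.
have : pr (lambda + simple_weight a) m != 0.
  by apply: contra_neq ne0 => ->; rewrite linear0.
by move=> /(hw_weight_le (pr_piece _ _)) /weight_le_addN.
Qed.

(** The weight space of [lambda] is the line through [v], since no [F a] has a component there. *)
Lemma hw_coeff_ex m : exists c : K, pr lambda m = c *: v.
Proof.
move: m; apply: gen_ind => [||a m _].
- split=> [|k u w [c uE] [d wE]]; first by exists 0; rewrite linear0 scale0r.
  by exists (k * c + d); rewrite linearP /= uE wE scalerDl scalerA.
- by exists 1; rewrite (pr_id vP) scale1r.
by exists 0; rewrite pr_hw_F scale0r.
Qed.

Definition hw_coeff (m : N) : K := projT1 (cid (hw_coeff_ex m)).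

Lemma hw_coeffE m c : pr lambda m = c *: v -> hw_coeff m = c.
Proof.
rewrite /hw_coeff; case: cid => d /= -> /eqP.
by rewrite -subr_eq0 -scalerBl scaler_eq0 (negPf v0) orbF subr_eq0 => /eqP.
Qed.

Lemma hw_coeffP m : pr lambda m = hw_coeff m *: v.
Proof. by rewrite /hw_coeff; case: cid. Qed.

(* [form_rel u f] means that [f] is the linear form [(u, .)]: the submodule of
   [N * N^*] generated by [(v, hw_coeff)], where [N^*] carries the action of [g]
   twisted by the Chevalley involution. *)
Inductive form_rel : N -> (N -> K) -> Prop :=
| form_rel_hw : form_rel v hw_coeff
| form_rel_F a u f : form_rel u f -> form_rel (F a u) (fun m => f (E a m))
| form_rel_lin c u f u' f' : form_rel u f -> form_rel u' f' ->
    form_rel (c *: u + u') (fun m => c * f m + f' m).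

Lemma form_rel_ext u u' f f' : form_rel u f -> u = u' -> f =1 f' -> form_rel u' f'.
Proof. by move=> uf <- /funext <-. Qed.

Lemma form_rel0 : form_rel 0 (fun=> 0).
Proof.
apply: form_rel_ext (form_rel_lin (-1) form_rel_hw form_rel_hw) _ _ => [|m].
  by rewrite scaleN1r addNr.
by rewrite mulN1r addNr.
Qed.

Lemma form_relZ c u f : form_rel u f -> form_rel (c *: u) (fun m => c * f m).
Proof.
move=> uf; apply: form_rel_ext (form_rel_lin c uf form_rel0) _ _ => [|m];
  by rewrite addr0.
Qed.

Lemma form_relD u u' f f' : form_rel u f -> form_rel u' f' ->
  form_rel (u + u') (fun m => f m + f' m).
Proof.
move=> uf uf'; apply: form_rel_ext (form_rel_lin 1 uf uf') _ _ => [|m].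
  by rewrite scale1r.
by rewrite mul1r.
Qed.

Lemma form_rel_scalar u f : form_rel u f -> scalar f.
Proof.
elim=> {u f} [c m m'|a u f _ IH c m m'|k u f u' f' _ IH _ IH' c m m'].
- by apply: hw_coeffE; rewrite linearP /= !hw_coeffP scalerDl scalerA.
- by rewrite linearP IH.
- rewrite IH IH' !mulrDr !mulrA [k * c]mulrC; exact: addrACA.
Qed.

(** The relation is graded, which will make the projections self-adjoint for the form. *)
Lemma form_rel_pr u f mu : form_rel u f -> form_rel (pr mu u) (fun m => f (pr mu m)).
Proof.
move=> uf; elim: uf mu => {u f} [mu|a u f _ IH mu|c u f u' f' _ IH _ IH' mu].
- rewrite (pr_piece_nat _ vP); case: eqVneq => [->|ml].
    apply: form_rel_ext form_rel_hw _ _ => // m.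
    by apply/esym/hw_coeffE; rewrite pr_pr eqxx hw_coeffP.
  apply: form_rel_ext form_rel0 _ _ => // m.
  by apply/esym/hw_coeffE; rewrite pr_pr eq_sym (negPf ml) scale0r.
- rewrite (pr_F EF); apply: form_rel_ext (form_rel_F a (IH _)) _ _ => // m.
  by rewrite (pr_E EF) addrK.
by rewrite linearP; exact: (form_rel_lin c (IH _) (IH' _)).
Qed.

Lemma form_rel_H u f a : form_rel u f ->
  form_rel (opH E F a u) (fun m => f (opH E F a m)).
Proof.
elim=> {u f} [|b u f uf IH|c u f u' f' _ IH _ IH'].
- apply: form_rel_ext (form_relZ (pairing R lambda (val a))%:~R form_rel_hw) _ _ => [|m].
    by rewrite /opH (chev_H EF _ vP).
  by apply/esym/hw_coeffE; rewrite (pr_opH EF) hw_coeffP scalerA.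
- have fl := form_rel_scalar uf.
  apply: form_rel_ext
    (form_rel_lin (- (cartan a b)%:~R) (form_rel_F b uf) (form_rel_F b IH)) _ _ => [|m].
    by have := opH_F EF a b u; rewrite adE => <-; rewrite subrK.
  have -> : E b (opH E F a m) = - (cartan a b)%:~R *: E b m + opH E F a (E b m).
    by have := opH_E EF a b m; rewrite scaleNr adE => <-; rewrite opprB subrK.
  by rewrite fl.
by rewrite linearP; exact: (form_rel_lin c IH IH').
Qed.

(** The relation is built to be stable under [F a]. Stability under [E a] is deduced by commuting
    [E a] with [F b] in both factors, where the Cartan term is covered by [form_rel_H]. *)
Lemma form_rel_E u f a : form_rel u f -> form_rel (E a u) (fun m => f (F a m)).
Proof.
elim=> {u f} [|b u f uf IH|c u f u' f' _ IH _ IH'].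
- rewrite vprim; apply: form_rel_ext form_rel0 _ _ => // m.
  by apply/esym/hw_coeffE; rewrite pr_hw_F scale0r.
- have fD m m' : f (m + m') = f m + f m'.
    by have := form_rel_scalar uf 1 m m'; rewrite scale1r mul1r.
  rewrite (EF_comm EF); case: (eqVneq a b) => [<-|ab].
    apply: form_rel_ext (form_relD (form_rel_F a IH) (form_rel_H a uf)) _ _ => // m.
    by rewrite (EF_comm EF) eqxx [RHS]fD.
  rewrite addr0; apply: form_rel_ext (form_rel_F b IH) _ _ => // m.
  by rewrite (EF_comm EF) eq_sym (negPf ab) addr0.
by rewrite linearP; exact: (form_rel_lin c IH IH').
Qed.

Lemma form_rel_v u f : form_rel u f -> f v = hw_coeff u.
Proof.
elim=> {u f} [//|a u f uf _|c u f u' f' _ IH _ IH'].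
  have fD m m' : f (m + m') = f m + f m'.
    by have := form_rel_scalar uf 1 m m'; rewrite scale1r mul1r.
  rewrite vprim; have -> : f 0 = 0 by apply: (addrI (f 0)); rewrite -fD !addr0.
  by apply/esym/hw_coeffE; rewrite pr_hw_F scale0r.
by rewrite IH IH'; apply/esym/hw_coeffE; rewrite linearP /= !hw_coeffP scalerDl scalerA.
Qed.

(** Here the relation becomes the graph of a function. By induction on the argument: the value at
    [v] is the coefficient of 0, and the value at [F a m] is that at [m] of a linear form related to
    [E a 0 = 0]. *)
Lemma form_rel_eq0 f : form_rel 0 f -> forall m, f m = 0.
Proof.
move=> f0 m; move: m f f0; apply: gen_ind => [|f f0|a m IH f f0] /=.
- split=> [f f0|c u w u0 w0 f f0].
    have := form_rel_scalar f0 (-1) 0 0.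
    by rewrite scaler0 addr0 mulN1r addNr.
  by rewrite (form_rel_scalar f0) u0 // w0 // mulr0 addr0.
- by rewrite (form_rel_v f0); apply: hw_coeffE; rewrite linear0 scale0r.
by apply: (IH (fun m => f (F a m))); rewrite -[X in form_rel X](linear0 (E a)); exact: form_rel_E.
Qed.

Lemma form_rel_uniq u f g : form_rel u f -> form_rel u g -> f =1 g.
Proof.
move=> uf ug m; have := @form_rel_eq0 (fun m => -1 * f m + g m).
have h : form_rel 0 (fun m => -1 * f m + g m).
  by apply: form_rel_ext (form_rel_lin (-1) uf ug) _ _ => //; rewrite scaleN1r addNr.
by move=> /(_ h m) /eqP; rewrite mulN1r addrC subr_eq0 => /eqP.
Qed.

Lemma form_rel_total u : exists f, form_rel u f.
Proof.
move: u; apply: gen_ind => [||a u [f uf]].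
- split=> [|c u w [f uf] [g wg]]; first by exists (fun=> 0); exact: form_rel0.
  by exists (fun m => c * f m + g m); exact: form_rel_lin.
- by exists hw_coeff; exact: form_rel_hw.
by exists (fun m => f (E a m)); exact: form_rel_F.
Qed.

Lemma contravariant_form : exists B : {biscalar N},
  [/\ forall u w, B u w = B w u, B v v = 1,
      forall (mu : X) u w, B (pr mu u) w = B u (pr mu w)
    & forall a u w, B (E a u) w = B u (F a w)].
Proof.
have [phi phiP] := choice form_rel_total.
have phi_lin : bilinear_for *%R *%R phi.
  split=> [m c u w|u]; last exact: form_rel_scalar (phiP u).
  exact: (form_rel_uniq (phiP _) (form_rel_lin c (phiP u) (phiP w))).
pose B : {biscalar N} :=
  HB.pack phi (bilinear_isBilinear.Build K N N K *%R *%R phi phi_lin).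
have BE a u w : B (E a u) w = B u (F a w).
  exact: (form_rel_uniq (phiP _) (form_rel_E a (phiP u))).
have BF a u w : B (F a u) w = B u (E a w).
  exact: (form_rel_uniq (phiP _) (form_rel_F a (phiP u))).
have Bv w : B v w = hw_coeff w by exact: (form_rel_uniq (phiP _) form_rel_hw).
have vB w : B w v = hw_coeff w by exact: form_rel_v (phiP w).
exists B; split=> [u w||mu u w|].
(* Symmetry holds at [v], where both sides are [hw_coeff w], and passes from [u] to [F a u] by
   adjointness in both directions. *)
- move: u w; apply: gen_ind => [|w|a u IH w].
  + split=> [w|c u u' IH IH' w]; first by rewrite linear0l linear0r.
    by rewrite linearPl linearPr IH IH'.
  + by rewrite Bv vB.
  by rewrite BF IH BE.
- by rewrite Bv; apply: hw_coeffE; rewrite (pr_id vP) scale1r.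
- exact: (form_rel_uniq (phiP _) (form_rel_pr mu (phiP u))).
exact: BE.
Qed.

End ContravariantForm.

(** * Non-degeneracy of the contravariant form on an irreducible representation *)

Section IrreducibleForm.
Context (rR : realType) (V : vectType rR) (R : root_system V)
  (Pi : root_basis R) (K : fieldType).
Local Notation X := (weight R).
Local Notation S := (simple Pi).

Definition contravariant (M : graded_space R K) (E F : S -> {linear M -> M})
    (B : {biscalar M}) :=
  [/\ forall u w, B u w = B w u, forall u, (forall w, B u w = 0) -> u = 0,
      forall (mu : X) u w, B (pr mu u) w = B u (pr mu w)
    & forall a u w, B (E a u) w = B u (F a w)].

Lemma irreducible_form (N : graded_rep Pi K) (lambda : X) : is_L lambda N ->
  exists (v : N) (B : {biscalar N}),
  [/\ piece lambda v, span_stable setT (repF (rep_act N)) [set v] = setT,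
      forall (mu : X) (m : N), piece mu m -> m != 0 -> weight_le Pi mu lambda
    & contravariant (repE (rep_act N)) (repF (rep_act N)) B].
Proof.
move=> [[_ irr] [v [v0 vP vprim vgen]]].
have EF := rep_chevalley_ops (rep_ok N).
have Fv : span_stable setT (repF (rep_act N)) [set v] = setT.
  apply/seteqP; split=> // m _; have : [set: N] m by [].
  rewrite -vgen; move: m; apply: span_stable_ind; last exact: span_stable_sub.
  exact: (hw_span_stable (rep_ok N) vP vprim).
have [B [Bsym Bv Bpr BE]] := contravariant_form EF vP v0 vprim Fv.
exists v, B; split=> //; first by move=> mu m; exact: (hw_weight_le EF vP Fv).
(* The radical [A] is a subrepresentation, and it is not everything because [B v v = 1]; by
   irreducibility it is 0. *)
split=> //; pose A : set N := [set u | forall w, B u w = 0].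
have sA : subspace A.
  split=> [w|c u u' u0 u'0 w]; first by rewrite linear0l.
  by rewrite linearPl u0 u'0 mulr0 addr0.
have [|A0|AT] := irr A.
- split; first by apply/graded_subspace_pr; split=> // mu u Au w; rewrite Bpr Au.
  apply: (rep_stable (rep_ok N) sA) => a u Au w; first by rewrite BE Au.
  by rewrite Bsym -BE Bsym Au.
- by move=> u Au; have : A u by []; rewrite A0.
have : A v by rewrite AT.
by move=> /(_ v); rewrite Bv => /eqP; rewrite oner_eq0.
Qed.

End IrreducibleForm.

(** * Components and inclusions of a direct sum of representations *)

Section DirectSum.
Context (rR : realType) (V : vectType rR) (R : root_system V)
  (Pi : root_basis R) (K : fieldType).
Local Notation X := (weight R).
Local Notation S := (simple Pi).
Context (M : graded_rep Pi K) (n : nat) (N : 'I_n -> graded_rep Pi K)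
  (phi : (forall i, N i) -> M) (psi : M -> forall i, N i).
Hypothesis phiL : forall (c : K) u v,
  phi (fun i => c *: u i + v i) = c *: phi u + phi v.
Hypothesis phiK : cancel phi psi.
Hypothesis psiK : cancel psi phi.
Hypothesis phi_piece : forall mu u, (forall i, piece mu (u i)) -> piece mu (phi u).
Hypothesis phi_act : forall x u,
  phi (fun i => rep_act (N i) x (u i)) = rep_act M x (phi u).

Definition inj i (x : N i) : forall j, N j := dfwith (fun j => 0 : N j) i x.

Lemma inj_in i (x : N i) : inj x i = x.
Proof. exact: dfwith_in. Qed.

Lemma inj_out i j (x : N i) : i != j -> inj x j = 0.
Proof. exact: dfwith_out. Qed.

Lemma inj_lin i c (x y : N i) : inj (c *: x + y) = fun j => c *: inj x j + inj y j.
Proof.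
apply: functional_extensionality_dep => j.
have [<-|ij] := eqVneq i j; first by rewrite !inj_in.
by rewrite !inj_out // scaler0 addr0.
Qed.

Lemma psi_lin c u v i : psi (c *: u + v) i = c *: psi u i + psi v i.
Proof. by rewrite -[in LHS](psiK u) -[in LHS](psiK v) -phiL phiK. Qed.

Fact psi_linear i : linear (psi^~ i).
Proof. by move=> c u v; exact: psi_lin. Qed.

Definition component i : {linear M -> N i} :=
  HB.pack (psi^~ i) (GRing.isLinear.Build K M (N i) *:%R (psi^~ i) (@psi_linear i)).

Fact phi_inj_linear i : linear (fun x : N i => phi (inj x)).
Proof. by move=> c x y; rewrite inj_lin phiL. Qed.

Definition inclusion i : {linear N i -> M} :=
  HB.pack (fun x : N i => phi (inj x))
    (GRing.isLinear.Build K (N i) M *:%R (fun x : N i => phi (inj x)) (@phi_inj_linear i)).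

Lemma component_inclusion i (x : N i) : component i (inclusion i x) = x.
Proof. by rewrite /= phiK inj_in. Qed.

Lemma component_inclusion_out i j (x : N i) : i != j -> component j (inclusion i x) = 0.
Proof. by move=> ij; rewrite /= phiK inj_out. Qed.

Lemma component_eq0 m : (forall i, component i m = 0) -> m = 0.
Proof.
move=> m0; rewrite -(psiK m) -(psiK 0); congr phi.
apply: functional_extensionality_dep => i.
by rewrite [LHS]m0 -[RHS]/(component i 0) linear0.
Qed.

Lemma component_act i x m : component i (rep_act M x m) = rep_act (N i) x (component i m).
Proof. by rewrite /= -{1}(psiK m) -phi_act phiK. Qed.

Lemma inclusion_act i x (m : N i) : inclusion i (rep_act (N i) x m) = rep_act M x (inclusion i m).
Proof.
rewrite /= -phi_act; congr phi; apply: functional_extensionality_dep => j.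
have [<-|ij] := eqVneq i j; first by rewrite !inj_in.
by rewrite !inj_out // linear0r.
Qed.

Lemma inclusion_sum m : m = \sum_i inclusion i (component i m).
Proof.
apply/subr0_eq/component_eq0 => i; rewrite linearB linear_sum (bigD1 i) // big1 => [|j ji].
  by rewrite [X in _ - (X + _)]component_inclusion addr0 subrr.
by rewrite [LHS]component_inclusion_out.
Qed.

(** Only [phi] is given as grading-preserving; that its inverse is so too is checked on homogeneous
    vectors of the single summands. *)
Lemma component_pr i (mu : X) m : component i (pr mu m) = pr mu (component i m).
Proof.
rewrite (inclusion_sum m) !linear_sum; apply: eq_bigr => j _.
move: (component j m) => {m}.
apply: (piece_ind (subspace_eq (component i \o pr mu \o inclusion j)
  (pr mu \o component i \o inclusion j))) => nu x xP.
have incP : piece nu (inclusion j x).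
  apply: phi_piece => k; have [<-|jk] := eqVneq j k; first by rewrite inj_in.
  by rewrite inj_out //; case: (piece_subspace (N k) nu).
change (component i (pr mu (inclusion j x)) = pr mu (component i (inclusion j x))).
rewrite (pr_piece_nat _ incP); have [eji|ji] := eqVneq j i.
  move: x xP incP; rewrite eji => x xP _; rewrite component_inclusion (pr_piece_nat _ xP).
  by case: ifP => _; rewrite ?component_inclusion ?linear0.
rewrite component_inclusion_out // linear0.
by case: ifP => _; rewrite ?component_inclusion_out ?linear0.
Qed.

Lemma component_piece i mu m : piece mu m -> piece mu (component i m).
Proof. by move=> mP; rewrite -(pr_id mP) component_pr; exact: pr_piece. Qed.

End DirectSum.

(** * The two implications *)

Section Equivalence.
Context (rR : realType) (V : vectType rR) (R : root_system V)
  (Pi : root_basis R) (K : fieldType).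
Local Notation X := (weight R).
Local Notation S := (simple Pi).

Lemma semisimple_HR_form (M : graded_rep Pi K) (F : S -> {linear M -> M}) :
  (forall a m, F a m = rep_act M (g_f K a) m) -> semisimple_rep M ->
  exists B : {biscalar M}, is_HR_form F B.
Proof.
move=> FE [n [N [lambda [NL [phi [phiL [psi phiK psiK] phi_piece phi_act]]]]]].
pose cp i := component phiL phiK psiK i.
pose ic i := inclusion phiL i.
have Bex i : {B : {biscalar N i} & exists v : N i,
    [/\ piece (lambda i) v, span_stable setT (repF (rep_act (N i))) [set v] = setT,
      forall (mu : X) (m : N i), piece mu m -> m != 0 -> weight_le Pi mu (lambda i)
    & contravariant (repE (rep_act (N i))) (repF (rep_act (N i))) B]}.
  by apply: cid; have [v [B vB]] := irreducible_form (NL i); exists B, v.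
pose b i := projT1 (Bex i).
have bP i := projT2 (Bex i).
have bC i : contravariant (repE (rep_act (N i))) (repF (rep_act (N i))) (b i).
  by have [v []] := bP i.
(* The orthogonal sum of the contravariant forms on the summands. *)
pose f (u w : M) : K := \sum_i b i (cp i u) (cp i w).
have f_lin : bilinear_for *%R *%R f.
  split=> [w c u u'|u c w w'] /=; rewrite /f mulr_sumr -big_split; apply: eq_bigr => i _.
    by rewrite linearP linearPl.
  by rewrite linearP linearPr.
pose B : {biscalar M} :=
  HB.pack f (bilinear_isBilinear.Build K M M K *%R *%R f f_lin).
have BE u w : B u w = \sum_i b i (cp i u) (cp i w) by [].
have Bic u i (x : N i) : B u (ic i x) = b i (cp i u) x.
  have cp_ic : cp i (ic i x) = x by exact: component_inclusion.
  rewrite BE (bigD1 i) // big1 => [|j ji]; first by rewrite cp_ic; exact: addr0.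
  have -> : cp j (ic i x) = 0 by apply: component_inclusion_out; rewrite eq_sym.
  exact: linear0r.
have Bpr (mu : X) u w : B (pr mu u) w = B u (pr mu w).
  rewrite !BE; apply: eq_bigr => i _; rewrite /cp !(component_pr _ _ _ phi_piece).
  by have [_ _ ->] := bC i.
have b_nondeg i u : (forall w, b i u w = 0) -> u = 0 by have [_ + _ _] := bC i; apply.
have cp_eq0 m : (forall i, cp i m = 0) -> m = 0 by exact: component_eq0.
exists B; split.
- by move=> u w; rewrite !BE; apply: eq_bigr => i _; have [-> _ _ _] := bC i.
- move=> u _ u0; apply: cp_eq0 => i; apply: b_nondeg => x.
  by rewrite -Bic u0.
- move=> mu nu u w ne uP wP; rewrite -(pr_id uP) Bpr (pr_piece_nat _ wP) (negPf ne).
  exact: linear0r.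
- move=> I Icl u Iu u0; apply: cp_eq0 => i.
  have [Ii|nIi] := pselect (I (lambda i)).
    (* For [lambda i] in [I], the space [M_I] contains the highest weight vector of the summand
       [N i], hence all of [N i], and the form on [N i] can be used. *)
    apply: b_nondeg => x; rewrite -Bic; apply: u0.
    have [v [vP vgen _ _]] := bP i.
    suff /(_ x): forall x, (ic i @^-1` M_closed F I) x by [].
    apply: (gen_ind vgen) => [||a m Im].
    + exact/subspace_preim/span_stable_subspace.
    + apply: span_stable_sub; exists (lambda i) => //.
      apply: phi_piece => j; have [<-|ij] := eqVneq i j; first by rewrite inj_in.
      by rewrite inj_out //; case: (piece_subspace (N j) (lambda i)).
    have icF : ic i (repF (rep_act (N i)) a m) = F a (ic i m).
      by rewrite FE; exact: inclusion_act.
    by rewrite /preimage /mkset icF; exact: (span_stable_stable setT F _).2.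
  (* For [lambda i] outside [I], no weight of [N i] lies in [I]: such a weight is at most
     [lambda i], and closedness would put [lambda i] in [I]. So [M_I] has no component in [N i]. *)
  suff : M_closed F I `<=` [set m | cp i m = 0] by apply.
  apply: span_stable_ind => [|m [mu Imu mP]].
    split=> [|a m _ m0].
      split=> [|c w w' w0 w'0]; rewrite /mkset ?linear0 // linearP.
      by rewrite [cp i w]w0 [cp i w']w'0 scaler0 addr0.
    by rewrite /mkset FE /cp (component_act phiL phiK psiK phi_act) m0 linear0r.
  apply/eqP/negPn/negP => m0; apply: nIi; apply: Icl Imu _.
  have [v [_ _ + _]] := bP i; apply; last exact: m0.
  exact: (component_piece _ _ _ phi_piece).
have EF := rep_chevalley_ops (rep_ok M).
have FE' a m : F a m = repF (rep_act M) a m by exact: FE.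
exists (repE (rep_act M)); split=> [a u w|a mu u uP|a c u ac].
- rewrite !BE; apply: eq_bigr => i _; rewrite FE /cp !(component_act phiL phiK psiK phi_act).
  by have [_ _ _ h] := bC i; exact: h.
- by rewrite !FE' -(chev_H EF a uP).
by rewrite !FE' -(chev_EF EF u ac).
Qed.

Lemma HR_form_semisimple (M : graded_space R K) (F : S -> {linear M -> M}) (B : {biscalar M}) :
  (forall a, homogeneous (- simple_weight a) (F a)) ->
  (exists T : set M, finite_set T /\ span_stable setT F T = setT) ->
  is_HR_form F B ->
  exists (rho : {bilinear g_alg Pi K -> M -> M}) (rho_rep : is_graded_rep rho),
     semisimple_rep (GradedRep rho_rep) /\
     forall a m, F a m = rho (g_f K a) m.
Proof.
move=> Fd [T [/finite_seqP[s ->] Fs]] BHR.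
have [E [BEF EF_H EF_0]] := HR_comm BHR.
have EF : chevalley_ops E F := HR_chevalley_ops Fd BHR BEF EF_H EF_0.
have serre a b ab := HR_serre Fd BHR BEF EF_H EF_0 (a := a) (b := b) Fs ab.
(* With the Serre relations at hand, all defining relations hold for [E] and [F], so the evaluation
   of words descends to the Lie algebra. *)
have [rho0 rho0E] := lie_eval_bilinear (opH_opH EF) (opH_E EF) (opH_F EF)
  (fun a b m ab => chev_EF EF m ab) (fun a b m ab => (serre a b ab).2 m)
  (fun a b m ab => (serre a b ab).1 m).
pose rho : {bilinear g_alg Pi K -> M -> M} := rho0.
have rhoE a m : rho (g_e K a) m = E a m by exact: rho0E.
have rhoF a m : rho (g_f K a) m = F a m by exact: rho0E.
have rho_br x y m : rho (g_br x y) m = rho x (rho y m) - rho y (rho x m).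
  elim/lie_piW: x => x; elim/lie_piW: y => y.
  by rewrite /g_br lie_brE !rho0E.
have rho_rep : is_graded_rep rho.
  split=> [//|a mu m mP|a mu m mP|a mu m mP|].
  - by rewrite rhoE; exact: (chev_E EF).
  - by rewrite rhoF; exact: (chev_F EF).
  - by rewrite -g_br_ef rho_br !rhoE !rhoF; exact: (chev_H EF).
  exists [set` s]; split; first exact: finite_seq.
  apply/seteqP; split=> // m _; have : [set: M] m by [].
  rewrite -Fs; move: m; apply: span_stable_ind; last exact: span_stable_sub.
  have [sA stA] := span_stable_stable (@g_bminus _ _ R Pi K) rho [set` s].
  by split=> // a m _ /(stA (g_f K a) m (g_f_bminus K a)); rewrite rhoF.
exists rho, rho_rep; split; last by move=> a m; rewrite rhoF.
(* The operators obtained from [rho] agree with [E] and [F] pointwise; the facts on [prim], [imF]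
   and generation are carried over to them. *)
have repEE : repE rho =2 E by move=> a m; exact: rhoE.
have [h bM] := fg_bounded Fd Fs.
have primE : prim (repE rho) = prim E.
  by apply/seteqP; split=> m pm a; have := pm a; rewrite repEE.
have imFE : imF (repF rho) = imF F.
  by apply/seteqP; split=> _ [f ->]; exists f; apply: eq_bigr => a _; rewrite -rhoF.
have Fs' : span_stable setT (repF rho) [set` s] = setT.
  rewrite -Fs; congr (span_stable _ _ _); apply: funext => a; apply: funext => m.
  exact: rhoF.
have pi0 : prim (repE rho) `&` imF (repF rho) `<=` [set 0].
  by rewrite primE imFE; exact: (HR_prim_imF Fd BHR BEF EF_H EF_0).
have [|n [x [lambda [xP xG xI]]]] := primitive_generators (rep_chevalley_ops rho_rep) Fs' _.
  move=> m; rewrite primE imFE.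
  exact: (HR_prim_split Fd BHR BEF Fs).
exact: (decomposition_semisimple rho_rep bM pi0 xP xG xI).
Qed.

End Equivalence.

Theorem theorem1 (rR : realType) (V : vectType rR) (R : root_system V)
    (Pi : root_basis R) (K : fieldType) (charK : 2%N \notin [pchar K])
    (M : graded_space R K) (F : simple Pi -> {linear M -> M})
    (F_homog : forall a : simple Pi, homogeneous (- simple_weight a) (F a))
    (M_fg : exists T : set M, finite_set T /\ span_stable setT F T = setT) :
  (exists B : {biscalar M}, is_HR_form F B)
  <->
  (exists (rho : {bilinear g_alg Pi K -> M -> M}) (rho_rep : is_graded_rep rho),
     semisimple_rep (GradedRep rho_rep) /\
     forall (a : simple Pi) (m : M), F a m = rho (g_f K a) m).
Proof.
split=> [[B BHR]|[rho [rho_rep [ss FE]]]]; first exact: HR_form_semisimple F_homog M_fg BHR.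
exact: (@semisimple_HR_form _ _ _ _ _ (GradedRep rho_rep) F FE ss).
Qed.
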